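(* Let $X=(X_{i_1,i_2})_{(i_1,i_2)\in[n]\times[m]}$ be a centered Gaussian random matrix with $\underline\sigma>0$ satisfying condition (A) of the context. For all $\varepsilon>0$ $$\mathcal{L}(\min\max X,\varepsilon)\le2\sqrt2\,\varepsilon\sum_{i_1=1}^n\frac{1}{\underline\sigma_{i_1}}\bigl(\sqrt2+\sqrt{\log m}\bigr)\le2\sqrt2\,\frac{\varepsilon}{\underline\sigma}\,n\bigl(\sqrt2+\sqrt{\log m}\bigr).$$
   Context: $[r]=\{1,\dots,r\}$. For an $n\times m$ matrix $z$, $\min\max z:=\min_{i_1\in[n]}\max_{i_2\in[m]}z_{i_1,i_2}$. For a random variable $Y$ and $\varepsilon>0$, $\mathcal{L}(Y,\varepsilon):=\sup_{x\in\mathbb{R}}\mathbf{P}(|Y-x|\le\varepsilon)$. Write $\sigma_{i_1,i_2}=\sqrt{\mathrm{Var}(X_{i_1,i_2})}$, $\underline\sigma_{i_1}=\min_{i_2\in[m]}\sigma_{i_1,i_2}$, $\underline\sigma=\min_{(i_1,i_2)}\sigma_{i_1,i_2}$. Condition (A): $\mathbf{P}\bigl(|\{(i_1,i_2)\in[n]\times[m]:X_{i_1,i_2}=\min\max X\}|>1\bigr)=0$. *)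

(* Defs.v *)
From HB Require Import structures.
From mathcomp Require Import all_boot all_order all_algebra.
From mathcomp Require Import all_classical all_reals all_analysis.

Set Implicit Arguments.
Unset Strict Implicit.
Unset Printing Implicit Defensive.

Import Order.TTheory GRing.Theory Num.Theory.
Import numFieldNormedType.Exports.

Local Open Scope classical_set_scope.
Local Open Scope ring_scope.

(* Minimum of finitely many reals indexed by a nonempty interval 'I_k.+1: the
   default value of the big operator is one of the terms, so it is harmless. *)
Definition min_ord (R : realType) (k : nat) (f : 'I_k.+1 -> R) : R :=
  \big[Num.min/f ord0]_(i < k.+1) f i.

Definition max_ord (R : realType) (k : nat) (f : 'I_k.+1 -> R) : R :=
  \big[Num.max/f ord0]_(i < k.+1) f i.

Definition minmax (R : realType) (n m : nat) (z : 'M[R]_(n.+1, m.+1)) : R :=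
  min_ord (fun i => max_ord (fun j => z i j)).

Definition levy_concentration d (T : measurableType d) (R : realType)
    (P : probability T R) (Y : T -> R) (eps : R) : \bar R :=
  ereal_sup (range (fun x : R => P [set w | `|Y w - x| <= eps])).

(* Univariate Gaussian law with mean [mu] and standard deviation [s]; for
   [s = 0], where [normal_prob] is not the point mass, it is the point mass at
   [mu]. *)
Definition gaussian_law (R : realType) (mu s : R) (A : set R) : \bar R :=
  if s == 0 then \d_mu A else normal_prob mu s A.

Section GaussianMatrix.
Context d (T : measurableType d) (R : realType) (P : probability T R).
Context (n m : nat).
Implicit Type X : 'I_n.+1 -> 'I_m.+1 -> {RV P >-> R}.

Definition sample X (w : T) : 'M[R]_(n.+1, m.+1) := \matrix_(i, j) X i j w.

(* The entries are jointly Gaussian: every linear combination of them has a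
   (possibly degenerate) Gaussian law.  The covariance may be singular. *)
Definition gaussian_matrix X : Prop :=
  forall a : 'M[R]_(n.+1, m.+1), exists mu s : R, 0 <= s /\
    forall A : set R, measurable A ->
      pushforward P (fun w => \sum_i \sum_j a i j * X i j w) A
        = gaussian_law mu s A.

Definition centered_matrix X : Prop :=
  forall i j, ('E_P[X i j] = 0)%E.

Definition sigma X i j : R := Num.sqrt (fine 'V_P[X i j]%E).

Definition sigma_row X i : R := min_ord (fun j => sigma X i j).

Definition sigma_min X : R :=
  \big[Num.min/sigma X ord0 ord0]_(p : 'I_n.+1 * 'I_m.+1) sigma X p.1 p.2.

Definition minmax_as_unique X : Prop :=
  P [set w | (1 < #|[pred p : 'I_n.+1 * 'I_m.+1 |
                      sample X w p.1 p.2 == minmax (sample X w)]|)%N] = 0%E.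

End GaussianMatrix.

(* Main.v *)
Require Import Defs.
From HB Require Import structures.
From mathcomp Require Import all_boot all_order all_algebra.
From mathcomp Require Import all_classical all_reals all_analysis.
From mathcomp Require Import measurable_realfun lebesgue_integral_under.
From mathcomp Require Import ring lra.

(** The minimum over the rows of the row maxima is one of the row maxima. So if it
    is within [eps] of [x], then so is the maximum of some row, and the union
    bound reduces the claim to one row: if [Y_1, ..., Y_p] are jointly Gaussian
    and centered with standard deviations [sd_k >= tau], then
    [P (`|max Y - x| <= eps) <= (2 * eps / tau) * (2 + a)] with
    [a = sqrt (2 * ln p)]. This is Nazarov's inequality,
    [gaussian_max_concentration].

    Fix a short interval [t - eta, t] and let [W_k = Y_k / sd_k],
    [y_k = t / sd_k], [delta = eta / tau]. If the maximum of the [Y_k] lies in the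
    interval, then all [W_k - y_k] are nonpositive and the largest of them,
    [W_j - y_j], is at least [- delta]. For fixed [j] let [rho_k] be the
    correlation of [W_j] and [W_k]; the residuals [Z_k = W_k - rho_k * W_j] are
    independent of [W_j]. That [j] realizes the largest deviation means
    [Z_k <= (1 - rho_k) * W_j + y_k - y_j] for all [k], and since [rho_k <= 1] the
    bound increases with [W_j]. Let [B_j] be the event that these bounds hold
    with [W_j] replaced by [y_j]: it depends on the residuals only, it holds when
    [j] is the argmax and [W_j <= y_j] ([argmax_residuals]), and it implies that
    [j] is the argmax when [W_j >= y_j] ([residuals_argmax]). With [g] the standard
    normal law, independence then gives two bounds: the probability of the
    interval is at most the sum of [P B_j * g [y_j - delta, y_j]], while the sum of
    [P B_j * g [y_j, +oo)] is at most 1 because the argmax is unique.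

    The two sums are compared by the one-dimensional estimate [normal_itv_le],
    [g [u - delta, u] <= delta * ((a + 5/4) * g [u, +oo) + 3/4 * exp (- a^2 / 2)],
    valid for all [u] once [delta] is small: it follows from the Mills bound
    [normal_pdf_mills] when [u <= a] and from the smallness of the density when
    [u > a]. As [exp (- a^2 / 2) = 1 / p], summation over [j] gives
    [delta * (a + 2)]. Long intervals are cut into short ones.

    Joint laws enter only through the laws of the linear combinations, so the
    independence of uncorrelated combinations ([polytope_indep]) has to be derived
    from one-dimensional information. A centered Gaussian variable [U] satisfies
    [E cos (U + c) = cos c * exp (- Var U / 2)] ([gaussian_rv_cos]), whence the
    factorization of expectations of products of cosines of uncorrelated
    combinations. The cosines are then replaced, one combination at a time, by
    indicators of half-lines, which are bounded pointwise limits of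
    trigonometric polynomials ([step_fun_cvg], [Ex_mul_lteif]). *)

Set Implicit Arguments.
Unset Strict Implicit.
Unset Printing Implicit Defensive.

Import Order.TTheory GRing.Theory Num.Theory.
Import numFieldNormedType.Exports.

Local Open Scope classical_set_scope.
Local Open Scope ring_scope.

(** * Integrals against the normal law *)

Section normal_density_integral.
Context {R : realType}.
Notation mu := (@lebesgue_measure R).
Variables (m s : R).

(** The density and the Radon-Nikodym derivative have the same integral over every
    measurable set, hence agree almost everywhere; so the change of variables
    along the derivative can be read with the density. *)
Lemma Radon_Nikodym_normal_prob :
  ae_eq mu setT
    (Radon_Nikodym_SigmaFinite.f (normal_prob m s) mu)
    (fun x => (normal_pdf m s x)%:E).
Proof.
have dom := normal_prob_dominates m s.
apply: integral_ae_eq => //.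
- exact: Radon_Nikodym_SigmaFinite.f_integrable.
- by apply/measurable_EFinP; exact: measurable_normal_pdf.
- move=> E _ mE; rewrite -Radon_Nikodym_SigmaFinite.f_integral//.
Qed.

Lemma ge0_integral_normal_prob (f : R -> \bar R) :
  measurable_fun setT f -> (forall x, (0 <= f x)%E) ->
  (\int[normal_prob m s]_x f x = \int[mu]_x (f x * (normal_pdf m s x)%:E))%E.
Proof.
move=> mf f0; have dom := normal_prob_dominates m s.
rewrite -(Radon_Nikodym_SigmaFinite.change_of_variables dom)//.
apply: ae_eq_integral => //.
- apply: emeasurable_funM => //.
  by apply: (measurable_int mu); exact: Radon_Nikodym_SigmaFinite.f_integrable.
- apply: emeasurable_funM => //; apply/measurable_EFinP.
  exact: measurable_normal_pdf.
- exact: ae_eqe_mul2l Radon_Nikodym_normal_prob.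
Qed.

Lemma integrable_normal_prob (f : R -> R) :
  measurable_fun setT f ->
  mu.-integrable setT (EFin \o (fun x => f x * normal_pdf m s x)) ->
  (normal_prob m s).-integrable setT (EFin \o f).
Proof.
move=> mf /integrableP[_ fi]; apply/integrableP; split; first exact/measurable_EFinP.
rewrite ge0_integral_normal_prob//; last first.
  by apply: measurableT_comp => //; exact/measurable_EFinP.
move: fi; apply: le_lt_trans; apply: ge0_le_integral => //=.
- by move=> x _; rewrite mule_ge0// lee_fin normal_pdf_ge0.
- apply: emeasurable_funM; last by apply/measurable_EFinP; exact: measurable_normal_pdf.
  by apply/measurable_EFinP; apply: measurableT_comp.
- apply/measurable_EFinP/measurableT_comp => //.
  by apply: measurable_funM => //; exact: measurable_normal_pdf.
- by move=> x _; rewrite lee_fin normrM (ger0_norm (normal_pdf_ge0 m s x)).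
Qed.

Lemma Rintegral_normal_prob (f : R -> R) :
  measurable_fun setT f ->
  mu.-integrable setT (EFin \o (fun x => f x * normal_pdf m s x)) ->
  \int[normal_prob m s]_x f x = \int[mu]_x (f x * normal_pdf m s x).
Proof.
move=> mf fi; have dom := normal_prob_dominates m s.
rewrite /Rintegral; congr fine.
rewrite -(Radon_Nikodym_change_of_variables dom)//=; last exact: integrable_normal_prob.
transitivity (\int[mu]_x ((f x)%:E * (normal_pdf m s x)%:E))%E; last first.
  by apply: eq_integral => x _; rewrite EFinM.
apply: ae_eq_integral => //.
- apply: emeasurable_funM; first exact/measurable_EFinP.
  by apply: (measurable_int mu); exact: Radon_Nikodym_integrable.
- apply: emeasurable_funM; first exact/measurable_EFinP.
  by apply/measurable_EFinP; exact: measurable_normal_pdf.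
- apply: ae_eqe_mul2l; apply: integral_ae_eq => //.
  + exact: Radon_Nikodym_integrable.
  + by apply/measurable_EFinP; exact: measurable_normal_pdf.
  + by move=> E _ mE; rewrite -Radon_Nikodym_integral.
Qed.

End normal_density_integral.

Section integral_of_derivative.
Context {R : realType}.
Notation mu := (@lebesgue_measure R).

(** Integration by parts on the whole line: by the fundamental theorem of
    calculus the integral of [f] over [-n, n] is [F n - F (- n)], which
    vanishes in the limit, and it converges to the integral of [f] by
    dominated convergence. *)
Lemma Rintegral_derive_eq0 (F f : R -> R) :
  continuous f -> (forall x : R, is_derive x (1 : R) F (f x)) ->
  mu.-integrable setT (EFin \o f) ->
  F x @[x --> +oo] --> 0 -> F x @[x --> -oo] --> 0 ->
  \int[mu]_x f x = 0.
Proof.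
move=> cf dF fi Fy FNy.
pose g n := f \_ `[(- n.+1%:R), n.+1%:R]%classic.
have cvg1 : (\int[mu]_x (g n x)%:E)%E @[n --> \oo] --> (\int[mu]_x (f x)%:E)%E.
  apply: (@dominated_cvg _ _ _ mu setT _ (fun n x => (g n x)%:E) _
    (fun x => `|(f x)%:E|%E)) => //.
  - move=> n; apply/measurable_EFinP; apply/measurable_restrict => //=.
    rewrite setTI; apply: measurable_funTS; exact: continuous_measurable_fun.
  - move=> x _; apply: cvg_near_cst.
    near=> n.
    rewrite /g patchE mem_set//= in_itv/= -ler_norml.
    near: n. 
    exists (Num.truncn `|x|) => // n /= xn.
    by apply/ltW/(lt_le_trans (truncnS_gt _)); rewrite ler_nat ltnS.
  - exact: integrable_abse fi.
  - move=> n x _; rewrite /g patchE lee_fin; case: ifPn => // _.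
    by rewrite normr0.
have cvg0 : (\int[mu]_x (g n x)%:E)%E @[n --> \oo] --> 0%:E.
  rewrite [X in X @ _ --> _](_ : _ = EFin \o (fun n => F n.+1%:R - F (- n.+1%:R))); last first.
    apply/funext => n /=; rewrite /g.
    transitivity (\int[mu]_(x in `[(- n.+1%:R)%R, n.+1%:R%R]) (f x)%:E)%E.
      by rewrite [RHS]integral_mkcond restrict_EFin.
    rewrite (@continuous_FTC2 _ _ F)//.
    - by rewrite gtrN.
    - exact: continuous_subspaceT.
    - have dFx x : derivable F x 1 by have := dF x; case.
      have cF : continuous F.
        by move=> x; apply/differentiable_continuous/derivable1_diffP.
      split => //; [exact/cvg_at_right_filter/cF|exact/cvg_at_left_filter/cF].
    - by move=> x _; rewrite derive1E; have [_] := dF x.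
  apply: cvg_EFin; first exact: nearW.
  rewrite -(subr0 0); apply: cvgB.
    apply: (@cvg_comp _ _ _ (fun n : nat => (n.+1%:R : R)) F _ _ _ _ Fy).
    apply/cvgryPge => A; near=> n.
    apply/ltW/(@lt_trans _ _ n%:R); last by rewrite ltr_nat.
    by near: n; move/cvgryPgt: (@cvgr_idn R); exact.
  apply: (@cvg_comp _ _ _ (fun n : nat => (- n.+1%:R : R)) F _ _ _ _ FNy).
  apply/cvgrNyPle => A; near=> n.
  rewrite lerNl; apply/ltW/(@lt_trans _ _ n%:R); last by rewrite ltr_nat.
  by near: n; move/cvgryPgt: (@cvgr_idn R); exact.
rewrite /Rintegral.
by rewrite -(cvg_unique _ cvg0 cvg1).
Unshelve. all: end_near. Qed.

End integral_of_derivative.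

(** * Moments and characteristic function of the normal law *)

Section normal_moments.
Context {R : realType}.
Notation mu := (@lebesgue_measure R).
Implicit Types m s x t : R.

Lemma is_derive_normal_pdf m s x : s != 0 ->
  is_derive x (1 : R) (normal_pdf m s) (- (x - m) / s ^+ 2 * normal_pdf m s x).
Proof.
move=> s0; rewrite normal_pdfE// /normal_fun.
apply: is_derive_eq.
rewrite /GRing.scale /=; set E := expR _.
by field.
Qed.

(** Boundary terms of the integrations by parts below vanish because they are
    bounded even after multiplication by [x - m]. *)
Lemma is_cvg0_of_bounded_mul (F : R -> R) m (C : R) :
  (forall x, `|(x - m) * F x| <= C) ->
  F x @[x --> +oo] --> 0 /\ F x @[x --> -oo] --> 0.
Proof.
move=> FC.
have C0 : 0 <= C by apply: le_trans (FC 0).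
have key e x : 0 < e -> C / e < `|x - m| -> `|F x| <= e.
  move=> e0 Cx; have xm : 0 < `|x - m| by apply: le_lt_trans Cx; rewrite divr_ge0// ltW.
  rewrite -(ler_pM2l xm) -normrM (le_trans (FC x))//.
  by move: Cx; rewrite ltr_pdivrMr// => /ltW.
split; apply/cvgr0Pnorm_le => e e0; near=> x; apply: key => //.
  rewrite (lt_le_trans _ (ler_norm _))// ltrBrDr; near: x.
  by apply: nbhs_pinfty_gt; rewrite num_real.
rewrite distrC (lt_le_trans _ (ler_norm _))// ltrBrDl -ltrBrDr; near: x.
by apply: nbhs_ninfty_lt; rewrite num_real.
Unshelve. all: end_near. Qed.

Lemma mul_expRN_le1 (u : R) : 0 <= u -> u * expR (- u) <= 1.
Proof.
move=> u0; rewrite expRN ler_pdivrMr ?expR_gt0// mul1r.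
by rewrite (le_trans _ (expR_ge1Dx _))// lerDr.
Qed.

Lemma sqr_normal_pdf_le m s x : s != 0 ->
  (x - m) ^+ 2 * normal_pdf m s x <= 2 * s ^+ 2 * normal_peak s.
Proof.
move=> s0; have s2 : 0 < s ^+ 2 by rewrite exprn_even_gt0.
rewrite normal_pdfE// /normal_fun.
set u := (x - m) ^+ 2 / (s ^+ 2 *+ 2).
have -> : - (x - m) ^+ 2 / (s ^+ 2 *+ 2) = - u by rewrite mulNr.
have -> : (x - m) ^+ 2 = u * (2 * s ^+ 2).
  by rewrite /u mulr_natl divfK// gt_eqF// pmulrn_lgt0.
rewrite (_ : u * _ * _ = (2 * s ^+ 2 * normal_peak s) * (u * expR (- u))); last by ring.
apply: ler_piMr; first by rewrite mulr_ge0 ?normal_peak_ge0// mulr_ge0// ltW.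
by rewrite mul_expRN_le1// divr_ge0 ?sqr_ge0// mulrn_wge0// ltW.
Qed.

Lemma normal_pdf_sqr_cvg0 m s : s != 0 ->
  (fun x => (x - m) * normal_pdf m s x) x @[x --> +oo] --> 0 /\
  (fun x => (x - m) * normal_pdf m s x) x @[x --> -oo] --> 0.
Proof.
move=> s0; apply: (@is_cvg0_of_bounded_mul _ m (2 * s ^+ 2 * normal_peak s)) => x.
rewrite mulrA -expr2 ger0_norm; last by rewrite mulr_ge0 ?sqr_ge0 ?normal_pdf_ge0.
exact: sqr_normal_pdf_le.
Qed.

Lemma normal_pdf_mul_cvg0 (g : R -> R) m s : s != 0 -> (forall x, `|g x| <= 1) ->
  (fun x => g x * normal_pdf m s x) x @[x --> +oo] --> 0 /\
  (fun x => g x * normal_pdf m s x) x @[x --> -oo] --> 0.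
Proof.
move=> s0 g1; apply: (@is_cvg0_of_bounded_mul _ m (normal_peak s + 2 * s ^+ 2 * normal_peak s)) => x.
have p0 := normal_pdf_ge0 m s x.
rewrite 2!normrM (ger0_norm p0).
apply: (@le_trans _ _ ((1 + (x - m) ^+ 2) * normal_pdf m s x)).
  rewrite mulrA ler_wpM2r// -(real_normK (num_real (x - m))).
  have := normr_ge0 (x - m); have := normr_ge0 (g x); have := g1 x; nra.
rewrite mulrDl mul1r lerD//; [exact: normal_pdf_ub|exact: sqr_normal_pdf_le].
Qed.

(** As [v * expR (- v) <= 1], half of the exponent absorbs the quadratic factor;
    the other half leaves a multiple of the normal density whose standard
    deviation is larger by the factor [Num.sqrt 2]. *)
Lemma integrable_sqr_normal_pdf m s : s != 0 ->
  mu.-integrable setT (EFin \o (fun x => (x - m) ^+ 2 * normal_pdf m s x)).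
Proof.
move=> s0; have s2 : 0 < s ^+ 2 by rewrite exprn_even_gt0.
pose r := Num.sqrt 2 * s.
have r0 : r != 0 by rewrite mulf_neq0// gt_eqF// sqrtr_gt0.
have r2 : r ^+ 2 = 2 * s ^+ 2 by rewrite exprMn sqr_sqrtr.
(* [C] collects the constants of [v * (4 * s ^+ 2)] and of the two peaks *)
pose C := 4 * s ^+ 2 * normal_peak s / normal_peak r.
apply: (@le_integrable _ _ _ mu setT measurableT _ (EFin \o (fun x => C * normal_pdf m r x))) => //.
- apply/measurable_EFinP; apply: measurable_funM; last exact: measurable_normal_pdf.
  by apply: measurable_funX; apply: measurable_funB.
- move=> x _ /=; rewrite lee_fin.
  have C0 : 0 <= C.
    by rewrite divr_ge0 ?normal_peak_ge0// mulr_ge0 ?normal_peak_ge0// mulr_ge0// ltW.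
  rewrite ger0_norm; last by rewrite mulr_ge0 ?sqr_ge0 ?normal_pdf_ge0.
  rewrite ger0_norm; last by rewrite mulr_ge0 ?normal_pdf_ge0.
  rewrite !normal_pdfE// /normal_fun r2.
  set v := (x - m) ^+ 2 / (2 * s ^+ 2 *+ 2).
  have -> : - (x - m) ^+ 2 / (2 * s ^+ 2 *+ 2) = - v by rewrite mulNr.
  have -> : - (x - m) ^+ 2 / (s ^+ 2 *+ 2) = - v + - v.
    by rewrite /v; field.
  have -> : (x - m) ^+ 2 = v * (4 * s ^+ 2).
    by rewrite /v; field.
  rewrite expRD /C [leRHS]mulrA divfK; last by rewrite gt_eqF// normal_peak_gt0.
  rewrite (_ : v * _ * _ = (4 * s ^+ 2 * normal_peak s * expR (- v)) * (v * expR (- v))); last by ring.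
  apply: ler_piMr.
    by rewrite mulr_ge0 ?expR_ge0// mulr_ge0 ?normal_peak_ge0// mulr_ge0// ltW.
  by rewrite mul_expRN_le1// divr_ge0 ?sqr_ge0// mulrn_wge0// mulr_ge0// ltW.
- have := integrableZl measurableT C (integrable_normal_pdf m r).
  by apply: eq_integrable.
Qed.

Lemma integrable_normal_pdf_mul m s (g : R -> R) :
  s != 0 -> measurable_fun setT g -> (forall x, `|g x| <= 1 + (x - m) ^+ 2) ->
  mu.-integrable setT (EFin \o (fun x => g x * normal_pdf m s x)).
Proof.
move=> s0 mg g1.
apply: (@le_integrable _ _ _ mu setT measurableT _
  (EFin \o (fun x => normal_pdf m s x + (x - m) ^+ 2 * normal_pdf m s x))) => //.
- apply/measurable_EFinP; apply: measurable_funM => //; exact: measurable_normal_pdf.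
- move=> x _ /=; rewrite lee_fin normrM (ger0_norm (normal_pdf_ge0 m s x)).
  rewrite -[X in X + _]mul1r -mulrDl (le_trans _ (ler_norm _))// ler_wpM2r//.
  exact: normal_pdf_ge0.
- have := integrableD measurableT (integrable_normal_pdf m s) (integrable_sqr_normal_pdf m s0).
  by apply: eq_integrable.
Qed.

Lemma Rintegral_normal_pdf m s : \int[mu]_x normal_pdf m s x = 1.
Proof. by rewrite /Rintegral integral_normal_pdf. Qed.

(** [(x - m) * normal_pdf m s x] is the derivative of
    [- s ^+ 2 * normal_pdf m s x]. *)
Lemma Rintegral_normal_mean m s : s != 0 ->
  \int[mu]_x ((x - m) * normal_pdf m s x) = 0.
Proof.
move=> s0.
have xi : mu.-integrable setT (EFin \o (fun x => (x - m) * normal_pdf m s x)).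
  apply: integrable_normal_pdf_mul => //; first exact: measurable_funB.
  move=> x; rewrite -(real_normK (num_real (x - m))); have := normr_ge0 (x - m); nra.
have [cy cNy] : ((fun x => 1 * normal_pdf m s x) x @[x --> +oo] --> 0 /\
    (fun x => 1 * normal_pdf m s x) x @[x --> -oo] --> 0).
  by apply: (@normal_pdf_mul_cvg0 (cst 1)) => // x; rewrite normr1.
pose F x := - s ^+ 2 * (1 * normal_pdf m s x).
apply: (@Rintegral_derive_eq0 _ F (fun x => (x - m) * normal_pdf m s x)).
- move=> x; apply: cvgM; last exact: continuous_normal_pdf.
  by apply: cvgB; [exact: cvg_id|exact: cvg_cst].
- move=> x; have := is_derive_normal_pdf m x s0 => d; rewrite /F.
  apply: is_derive_eq; rewrite /GRing.scale/=.
  by field.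
- exact: xi.
- rewrite -(mulr0 (- s ^+ 2)); apply: cvgM; [exact: cvg_cst|exact: cy].
- rewrite -(mulr0 (- s ^+ 2)); apply: cvgM; [exact: cvg_cst|exact: cNy].
Qed.

(** The derivative of [- s ^+ 2 * (x - m) * normal_pdf m s x] is
    [(x - m) ^+ 2 * normal_pdf m s x - s ^+ 2 * normal_pdf m s x]. *)
Lemma Rintegral_normal_variance m s : s != 0 ->
  \int[mu]_x ((x - m) ^+ 2 * normal_pdf m s x) = s ^+ 2.
Proof.
move=> s0.
have [cy cNy] := normal_pdf_sqr_cvg0 m s0.
pose F x := - s ^+ 2 * ((x - m) * normal_pdf m s x).
have pi := integrable_normal_pdf m s.
have p2i := integrable_sqr_normal_pdf m s0.
have spi : mu.-integrable setT (EFin \o (fun x => s ^+ 2 * normal_pdf m s x)).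
  by have := integrableZl measurableT (s ^+ 2) pi; apply: eq_integrable.
have : \int[mu]_x ((x - m) ^+ 2 * normal_pdf m s x - s ^+ 2 * normal_pdf m s x) = 0.
  apply: (@Rintegral_derive_eq0 _ F (fun x => (x - m) ^+ 2 * normal_pdf m s x - s ^+ 2 * normal_pdf m s x)).
  - move=> x; apply: cvgB; apply: cvgM; try exact: continuous_normal_pdf.
      apply: (cvg_comp _ (fun x => x ^+ 2)); last exact: sqr_continuous.
      by apply: cvgB; [exact: cvg_id|exact: cvg_cst].
    exact: cvg_cst.
  - move=> x; have := is_derive_normal_pdf m x s0 => d; rewrite /F.
    apply: is_derive_eq; rewrite /GRing.scale/=.
    by field.
  - by have := integrableB measurableT p2i spi; apply: eq_integrable.
  - rewrite -(mulr0 (- s ^+ 2)); apply: cvgM; [exact: cvg_cst|exact: cy].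
  - rewrite -(mulr0 (- s ^+ 2)); apply: cvgM; [exact: cvg_cst|exact: cNy].
rewrite RintegralB// RintegralZl//= Rintegral_normal_pdf mulr1.
by move/eqP; rewrite subr_eq0 => /eqP.
Qed.

(** The real part of [e^(i c)] times the characteristic function at [t]; the
    phase [c] treats the cosine and the sine transforms at once. *)
Definition normal_cos_transform c s t := \int[mu]_x (cos (t * x + c) * normal_pdf 0 s x).

Lemma continuous_cos_scale t c : continuous (fun x : R => cos (t * x + c)).
Proof.
move=> x; apply: (cvg_comp _ (@cos R)); last exact: continuous_cos.
by apply: cvgD; [apply: cvgM; [exact: cvg_cst|exact: cvg_id]|exact: cvg_cst].
Qed.

Lemma continuous_sin_scale t c : continuous (fun x : R => sin (t * x + c)).
Proof.
move=> x; apply: (cvg_comp _ (@sin R)); last exact: continuous_sin.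
by apply: cvgD; [apply: cvgM; [exact: cvg_cst|exact: cvg_id]|exact: cvg_cst].
Qed.

Lemma integrable_cos_normal_pdf s t c : s != 0 ->
  mu.-integrable setT (EFin \o (fun x => cos (t * x + c) * normal_pdf 0 s x)).
Proof.
move=> s0; apply: integrable_normal_pdf_mul => //.
  by apply: continuous_measurable_fun; exact: continuous_cos_scale.
by move=> x; rewrite (le_trans (cos_max _))// lerDl sqr_ge0.
Qed.

Lemma integrable_xsin_normal_pdf s t c : s != 0 ->
  mu.-integrable setT (EFin \o (fun x => x * sin (t * x + c) * normal_pdf 0 s x)).
Proof.
move=> s0; apply: integrable_normal_pdf_mul => //.
  apply: measurable_funM => //.
  by apply: continuous_measurable_fun; exact: continuous_sin_scale.
move=> x; rewrite subr0 normrM -(real_normK (num_real x)).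
have := sin_max (t * x + c); have := normr_ge0 x; have := normr_ge0 (sin (t * x + c)); nra.
Qed.

(** Integration by parts of [sin (t x + c)] against the derivative
    [- x / s ^+ 2 * normal_pdf 0 s x] of the density. *)
Lemma Rintegral_xsin_normal s t c : s != 0 ->
  \int[mu]_x (x * sin (t * x + c) * normal_pdf 0 s x) =
    s ^+ 2 * t * normal_cos_transform c s t.
Proof.
move=> s0.
have [cy cNy] : ((fun x => sin (t * x + c) * normal_pdf 0 s x) x @[x --> +oo] --> 0 /\
    (fun x => sin (t * x + c) * normal_pdf 0 s x) x @[x --> -oo] --> 0).
  by apply: (@normal_pdf_mul_cvg0 (fun x => sin (t * x + c))) => // x; exact: sin_max.
pose F x := - s ^+ 2 * (sin (t * x + c) * normal_pdf 0 s x).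
have ci := integrable_cos_normal_pdf t c s0.
have si := integrable_xsin_normal_pdf t c s0.
have spi : mu.-integrable setT
    (EFin \o (fun x => s ^+ 2 * t * (cos (t * x + c) * normal_pdf 0 s x))).
  by have := integrableZl measurableT (s ^+ 2 * t) ci; apply: eq_integrable.
have : \int[mu]_x (x * sin (t * x + c) * normal_pdf 0 s x -
    s ^+ 2 * t * (cos (t * x + c) * normal_pdf 0 s x)) = 0.
  apply: (@Rintegral_derive_eq0 _ F (fun x => x * sin (t * x + c) * normal_pdf 0 s x -
    s ^+ 2 * t * (cos (t * x + c) * normal_pdf 0 s x))).
  - move=> x; apply: cvgB.
      apply: cvgM; last exact: continuous_normal_pdf.
      by apply: cvgM; [exact: cvg_id|exact: continuous_sin_scale].
    apply: cvgM; first exact: cvg_cst.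
    by apply: cvgM; [exact: continuous_cos_scale|exact: continuous_normal_pdf].
  - move=> x; have := is_derive_normal_pdf 0 x s0 => d; rewrite /F.
    apply: is_derive_eq; rewrite /GRing.scale/= subr0.
    by field.
  - by have := integrableB measurableT si spi; apply: eq_integrable.
  - rewrite -(mulr0 (- s ^+ 2)); apply: cvgM; [exact: cvg_cst|exact: cy].
  - rewrite -(mulr0 (- s ^+ 2)); apply: cvgM; [exact: cvg_cst|exact: cNy].
rewrite RintegralB// RintegralZl//=.
by move/eqP; rewrite subr_eq0 => /eqP.
Qed.

(** Differentiating under the integral sign produces the factor [- x], which the
    previous integration by parts turns back into the transform itself: a
    linear differential equation that determines it. *)
Lemma is_derive_normal_cos_transform c s t : s != 0 ->
  is_derive t (1 : R) (normal_cos_transform c s)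
    (- (s ^+ 2 * t * normal_cos_transform c s t)).
Proof.
move=> s0.
pose f t x := cos (t * x + c) * normal_pdf 0 s x.
have df u x : is_derive u (1 : R) (fun t => f t x) (- (x * sin (u * x + c) * normal_pdf 0 s x)).
  rewrite /f; apply: is_derive_eq; rewrite /GRing.scale/=; ring.
have fE u x : partial1of2 f u x = - (x * sin (u * x + c) * normal_pdf 0 s x).
  by rewrite /partial1of2 derive1E; have [_] := df u x.
have It : (`]t - 1, t + 1[%classic : set R) t.
  by rewrite /= in_itv/= gtrBl ltrDl ltr01.
have Gi : mu.-integrable setT
    (EFin \o (fun x => (1 + (x - 0) ^+ 2) * normal_pdf 0 s x)).
  apply: integrable_normal_pdf_mul => //.
    by apply: measurable_funD => //; apply: measurable_funX; apply: measurable_funB.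
  by move=> x; rewrite ger0_norm// addr_ge0// sqr_ge0.
have H1 : forall x, `]t - 1, t + 1[%classic x -> mu.-integrable setT (EFin \o f x).
  by move=> x _; exact: integrable_cos_normal_pdf.
have H2 : forall x y : R, `]t - 1, t + 1[%classic x -> setT y -> derivable (f ^~ y) x 1.
  by move=> x y _ _; have := df x y; case.
have H3 : forall y, 0 <= (1 + (y - 0) ^+ 2) * normal_pdf 0 s y :> R.
  by move=> y; rewrite mulr_ge0 ?normal_pdf_ge0// addr_ge0// sqr_ge0.
have H4 : forall x y : R, `]t - 1, t + 1[%classic x -> setT y ->
   `|partial1of2 f x y| <= (1 + (y - 0) ^+ 2) * normal_pdf 0 s y.
  move=> u x _ _; rewrite fE normrN normrM (ger0_norm (normal_pdf_ge0 0 s x)).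
  rewrite ler_wpM2r ?normal_pdf_ge0// subr0 normrM -(real_normK (num_real x)).
  have := sin_max (u * x + c); have := normr_ge0 x; have := normr_ge0 (sin (u * x + c)); nra.
apply: DeriveDef.
  exact: (derivable_under_integral measurableT It H1 H2 H3 Gi H4).
rewrite -derive1E.
rewrite (differentiation_under_integral measurableT It H1 H2 H3 Gi H4).
under eq_Rintegral do rewrite fE.
rewrite -(Rintegral_xsin_normal _ _ s0).
under eq_Rintegral do rewrite -mulN1r.
by rewrite RintegralZl ?mulN1r//; exact: integrable_xsin_normal_pdf.
Qed.

(** The differential equation says that the product of the transform with
    [expR (s ^+ 2 * t ^+ 2 / 2)] is constant in [t]; compare [t = 1] with
    [t = 0]. *)
Lemma Rintegral_cos_normal s c : s != 0 ->
  \int[mu]_x (cos (x + c) * normal_pdf 0 s x) = cos c * expR (- s ^+ 2 / 2).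
Proof.
move=> s0.
pose k t := normal_cos_transform c s t * expR (s ^+ 2 * (t ^+ 2 / 2)).
have kE : k 1 = k 0.
  apply: is_derive_0_is_cst => t; have := is_derive_normal_cos_transform c t s0 => d; rewrite /k.
  apply: is_derive_eq; rewrite /GRing.scale/=.
  by field.
have h0 : normal_cos_transform c s 0 = cos c.
  rewrite /normal_cos_transform; under eq_Rintegral do rewrite mul0r add0r.
  rewrite RintegralZl ?Rintegral_normal_pdf ?mulr1//; exact: integrable_normal_pdf.
move: kE; rewrite /k h0 expr0n/= mul0r mulr0 expR0 mulr1 expr1n => kE.
have -> : \int[mu]_x (cos (x + c) * normal_pdf 0 s x) = normal_cos_transform c s 1.
  by apply: eq_Rintegral => x _; rewrite mul1r.
have e0 : expR (s ^+ 2 / 2) != 0 by rewrite gt_eqF// expR_gt0.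
rewrite mulNr expRN; apply: (mulIf e0); rewrite mulfVK// -[RHS]kE.
by rewrite mul1r.
Qed.

End normal_moments.

(** * Gaussian tails and the mass of short intervals *)

Section normal_tail.
Context {R : realType}.
Notation mu := (@lebesgue_measure R).
Notation phi := (@normal_pdf R 0 1).
Notation gauss := (@normal_prob R 0 1).
Implicit Types a u v x : R.

Definition normal_tail u : R := fine (gauss `[u, +oo[%classic).

Lemma normal_tail_ge0 u : 0 <= normal_tail u.
Proof. by rewrite /normal_tail fine_ge0// measure_ge0. Qed.

Lemma normal_tail_le u v : u <= v -> normal_tail v <= normal_tail u.
Proof.
move=> uv; rewrite /normal_tail fine_le ?fin_num_measure//.
apply: le_measure; rewrite ?inE//.
by apply: subset_itvr; rewrite bnd_simp.
Qed.

Lemma normal_pdf01E x : phi x = normal_peak 1 * expR (- (x ^+ 2) / 2).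
Proof. by rewrite normal_pdfE ?oner_neq0// /normal_fun subr0 expr1n. Qed.

Lemma normal_peak1_le : normal_peak 1 <= 2^-1 :> R.
Proof.
have p2 : (2 : R) <= pi := @pi_ge2 R.
have pp : 0 < 1 ^+ 2 * pi *+ 2 :> R by rewrite expr1n mul1r mulrn_wgt0// pi_gt0.
rewrite /normal_peak lef_pV2 ?posrE ?sqrtr_gt0//.
rewrite -[leLHS](ger0_norm (ler0n R 2)) -sqrtr_sqr ler_sqrt ?(ltW pp)//.
rewrite expr1n mul1r -mulr_natr; lra.
Qed.

(** A Mills ratio bound. The function [phi x / (x + 1)] tends to 0 at infinity and
    its derivative is at least [- phi x], because
    [x * (x + 1) + 1 <= (x + 1) ^+ 2]; so its value at [u] is at most the
    integral of [phi] beyond [u]. *)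
Lemma normal_pdf_mills u : 0 <= u -> phi u <= (u + 1) * normal_tail u.
Proof.
move=> u0.
pose F x := phi x / (x + 1).
have pos x : 0 <= x -> 0 < x + 1 by lra.
(* the decrease of [F] is the integral of [- F'], which [phi] dominates *)
have step v : u < v -> F u <= normal_tail u + F v.
  move=> uv.
  pose f x := phi x * (x / (x + 1) + ((x + 1)^-1) ^+ 2).
  have dF x : 0 <= x -> is_derive x (1 : R) (fun x => - F x) (f x).
    move=> x0; have d := is_derive_normal_pdf 0 x (@oner_neq0 R).
    have x1 : x + 1 != 0 by rewrite gt_eqF// pos.
    have d2 : is_derive x (1:R) (fun x => (x + 1)^-1) (- ((x + 1)^-1) ^+ 2).
      have d1 : is_derive x (1:R) (fun x => x + 1) 1.
        by apply: is_derive_eq; rewrite addr0.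
      have dV := is_deriveV (f := fun x => x + 1) x1 d1.
      by apply: is_derive_eq; rewrite /GRing.scale/= mulr1 exprVn.
    rewrite /F; apply: is_derive_eq; rewrite /GRing.scale/= /f subr0 expr1n.
    by field.
  have cF x : 0 <= x -> {for x, continuous (fun x => - F x)}.
    by move=> x0; apply/differentiable_continuous/derivable1_diffP; case: (dF _ x0).
  have cf x : 0 <= x -> {for x, continuous f}.
    move=> x0; have x1 : x + 1 != 0 by rewrite gt_eqF// pos.
    have c1 : {for x, continuous (fun x => (x + 1)^-1)}.
      by apply: cvgV => //; apply: cvgD; [exact: cvg_id|exact: cvg_cst].
    apply: cvgM; first exact: continuous_normal_pdf.
    apply: cvgD; first by apply: cvgM; [exact: cvg_id|exact: c1].
    by apply: (cvg_comp _ (fun x => x ^+ 2)); [exact: c1|exact: sqr_continuous].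
  have wcf : {within `[u, v], continuous f}.
    apply: continuous_in_subspaceT => x; rewrite inE/= in_itv/= => /andP[ux _].
    by apply: cf; exact: le_trans ux.
  have ftc : (\int[mu]_(x in `[u, v]) (f x)%:E = (- F v)%:E - (- F u)%:E)%E.
    apply: (@continuous_FTC2 _ f (fun x => - F x) u v) => //.
    - split.
      + move=> x; rewrite in_itv/= => /andP[ux _].
        have /dF : 0 <= x by rewrite ltW// (le_lt_trans u0).
        by case.
      + by apply: cvg_at_right_filter; exact: cF.
      + by apply: cvg_at_left_filter; apply: cF; rewrite ltW// (le_lt_trans u0).
    - move=> x; rewrite in_itv/= => /andP[ux _]; rewrite derive1E.
      have /dF : 0 <= x by rewrite ltW// (le_lt_trans u0).
      by case.
  have le1 : (\int[mu]_(x in `[u, v]) (f x)%:E <= gauss `[u, v])%E.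
    rewrite /normal_prob; apply: ge0_le_integral => //.
    - move=> x /=; rewrite in_itv/= => /andP[ux _]; rewrite lee_fin.
      have x0 : 0 <= x := le_trans u0 ux.
      by rewrite mulr_ge0 ?normal_pdf_ge0// addr_ge0 ?sqr_ge0// divr_ge0// ltW// pos.
    - by apply/measurable_EFinP; exact: subspace_continuous_measurable_fun.
    - by apply/measurable_EFinP; apply: measurable_funTS; exact: measurable_normal_pdf.
    - move=> x /=; rewrite in_itv/= => /andP[ux _]; rewrite lee_fin.
      have x0 : 0 <= x := le_trans u0 ux.
      rewrite ler_piMr ?normal_pdf_ge0//.
      rewrite -(ler_pM2r (exprn_gt0 2 (pos _ x0))) mulrDl -exprMn mulVf ?gt_eqF ?pos//.
      rewrite expr2 mulrA mulfVK ?gt_eqF ?pos//; nra.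
  rewrite -lerBlDr -lee_fin /normal_tail fineK ?fin_num_measure//.
  rewrite addrC -[F u]opprK EFinB -ftc (le_trans le1)//.
  by apply: le_measure; rewrite ?inE//; apply: subset_itvl.
have Fu : F u <= normal_tail u.
  apply/ler_addgt0Pr => e e0.
  (* [v] is so large that [F v <= e] *)
  pose v := u + 1 + e^-1.
  have ie : 0 < e^-1 by rewrite invr_gt0.
  have uv : u < v by rewrite /v; lra.
  apply: (le_trans (step _ uv)); rewrite lerD2l /F.
  rewrite ler_pdivrMr; last by apply: pos; rewrite /v; lra.
  apply: (@le_trans _ _ 1).
    rewrite (le_trans (normal_pdf_ub _ _ (@oner_neq0 R)))//.
    by rewrite (le_trans normal_peak1_le)//; lra.
  rewrite -[leLHS](@mulfV _ e) ?gt_eqF// ler_pM2l// /v; lra.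
by rewrite mulrC -ler_pdivrMr// pos.
Qed.

Lemma normal_pdf_le_tail a u : 0 <= a -> u <= a -> phi u <= (a + 1) * normal_tail u.
Proof.
move=> a0 ua; have [u0|u0] := leP 0 u.
  apply: (le_trans (normal_pdf_mills u0)).
  by rewrite ler_wpM2r ?normal_tail_ge0// lerD2r.
apply: (@le_trans _ _ (phi 0)).
  rewrite !normal_pdf01E ler_wpM2l ?normal_peak_ge0// ler_expR; nra.
apply: (le_trans (normal_pdf_mills (lexx 0))); rewrite add0r mul1r.
apply: (le_trans (normal_tail_le (ltW u0))).
by rewrite ler_peMl ?normal_tail_ge0// lerDr.
Qed.

(** If [u <= a], the density on [u - d, u] exceeds [phi u] by a factor at most
    [expR (a * d)], and [phi u] is at most [(a + 1) * normal_tail u]. If [u > a],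
    the density there is at most [phi 0 * expR (- a ^+ 2 / 2 + a * d)], with
    [phi 0 <= 1 / 2]. The condition on [d] keeps [expR (a * d)] so close to 1
    that the constants [a + 5 / 4] and [3 / 4] are enough; what matters later
    is that they add up to [a + 2]. *)
Lemma normal_itv_le a d u : 0 <= a -> 0 <= d -> a * d * (4 * a + 5) <= 1 ->
  fine (gauss `[u - d, u]%classic) <=
    d * ((a + 5 / 4) * normal_tail u + 3 / 4 * expR (- a ^+ 2 / 2)).
Proof.
move=> a0 d0 ad.
set B := (a + 5 / 4) * _ + _.
have ead : expR (a * d) <= (4 * a + 5) / (4 * a + 4).
  rewrite -[a * d]opprK expRN -[leRHS]invf_div lef_pV2 ?posrE ?expR_gt0//; last first.
    by rewrite divr_gt0; lra.
  apply: le_trans (expR_ge1Dx _).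
  rewrite ler_pdivrMr; last by lra.
  nra.
have a4 : 0 < 4 * a + 4 by lra.
have bound x : u - d <= x -> x <= u -> phi x <= B.
  move=> dx xu; have T0 := normal_tail_ge0 u.
  have E0 : 0 < expR (- a ^+ 2 / 2) by exact: expR_gt0.
  have [ua|ua] := leP u a.
    apply: (@le_trans _ _ ((a + 5 / 4) * normal_tail u)); last first.
      by rewrite /B lerDl mulr_ge0 ?expR_ge0//; lra.
    apply: (@le_trans _ _ (phi u * expR (a * d))).
      rewrite !normal_pdf01E -mulrA -expRD ler_wpM2l ?normal_peak_ge0// ler_expR.
      nra.
    apply: (le_trans (ler_wpM2l (normal_pdf_ge0 _ _ _) ead)).
    have := normal_pdf_le_tail a0 ua.
    have : (a + 5 / 4) * (4 * a + 4) = (a + 1) * (4 * a + 5) by lra.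
    rewrite mulrA ler_pdivrMr// => e p.
    by rewrite mulrAC e mulrAC ler_wpM2r//; lra.
  apply: (@le_trans _ _ (3 / 4 * expR (- a ^+ 2 / 2))); last first.
    by rewrite /B lerDr mulr_ge0 ?normal_tail_ge0//; lra.
  have ead2 : expR (a * d) <= 5 / 4.
    by apply: (le_trans ead); rewrite ler_pdivrMr//; lra.
  apply: (@le_trans _ _ (normal_peak 1 * (expR (- a ^+ 2 / 2) * expR (a * d)))).
    rewrite normal_pdf01E ler_wpM2l ?normal_peak_ge0// -expRD ler_expR.
    have : 0 <= (x - a) * (x + a) + 2 * (a * d).
      have [xa|xa] := leP a x; first by rewrite addr_ge0 ?mulr_ge0//; lra.
      have [s0|s0] := leP 0 (x + a); last first.
        by have := mulr_ge0 a0 d0; have : 0 < (a - x) * - (x + a); [rewrite mulr_gt0//; lra|lra].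
      have h1 : 0 <= (d - (a - x)) * (x + a) by rewrite mulr_ge0//; lra.
      have h2 : 0 <= d * (a - x) by rewrite mulr_ge0//; lra.
      nra.
    nra.
  have p0 := normal_peak_ge0 (1 : R); have p1 := normal_peak1_le.
  have e1 := expR_gt0 (a * d).
  apply: (@le_trans _ _ (2^-1 * (expR (- a ^+ 2 / 2) * (5 / 4)))); last by lra.
  apply: ler_pM => //.
  by rewrite ler_wpM2l// expR_ge0.
rewrite -lee_fin fineK ?fin_num_measure//.
apply: (@le_trans _ _ (\int[mu]_(x in `[(u - d)%R, u]) B%:E)%E).
  rewrite /normal_prob; apply: ge0_le_integral => //.
  - by move=> x _; rewrite lee_fin normal_pdf_ge0.
  - by apply/measurable_EFinP; apply: measurable_funTS; exact: measurable_normal_pdf.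
  - by move=> x /=; rewrite in_itv/= => /andP[dx xu]; rewrite lee_fin bound.
rewrite integral_cst//= lebesgue_measure_itv/= lte_fin gtrBl.
case: ltgtP d0 => // [d0 _|<- _]; last by rewrite mule0 mul0r.
by rewrite -EFinB -EFinM lee_fin opprB addrC subrK mulrC.
Qed.

End normal_tail.

(** * Step functions approximated by trigonometric polynomials *)

Section trigonometric_step.
Context {R : realType}.
Implicit Types s x v b : R.

Lemma bernoulli_le x k : -1 <= x -> 1 + k%:R * x <= (1 + x) ^+ k.
Proof.
move=> x1; elim: k => [|k IH]; first by rewrite mul0r addr0 expr0.
rewrite exprS; apply: (@le_trans _ _ ((1 + x) * (1 + k%:R * x))).
  rewrite -natr1; have : 0 <= k%:R * x ^+ 2 by rewrite mulr_ge0// sqr_ge0.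
  rewrite expr2; lra.
by rewrite ler_wpM2l//; lra.
Qed.

(** As [((1 + s) / 2) ^+ N * 2 ^ N] is [(1 + s) ^+ N], Bernoulli's inequality
    shows that this polynomial in [s] is close to 1 when [N * s] is very
    negative and close to 0 when [N * s] is very large, while it stays in
    [0, 1] for [s] in [-1, 1]. *)
Definition step_pow (N : nat) s := (1 - ((1 + s) / 2) ^+ N) ^+ (2 ^ N).

Lemma step_pow_base N s : `|s| <= 1 -> 0 <= 1 - ((1 + s) / 2) ^+ N <= 1.
Proof.
rewrite ler_norml => /andP[s0 s1].
have y0 : 0 <= (1 + s) / 2 by lra.
have y1 : (1 + s) / 2 <= 1 by lra.
by rewrite subr_ge0 exprn_ile1//= gerBl exprn_ge0.
Qed.

Lemma step_pow_01 N s : `|s| <= 1 -> 0 <= step_pow N s <= 1.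
Proof.
move=> /(step_pow_base N)/andP[h0 h1].
by rewrite exprn_ge0//= exprn_ile1.
Qed.

Let two_pow N s : (2 ^ N)%:R * ((1 + s) / 2) ^+ N = (1 + s) ^+ N.
Proof. by rewrite natrX -exprMn mulrC divfK. Qed.

Lemma step_pow_neg N s : -1 <= s -> s <= 0 -> 1 - (1 + N%:R * - s)^-1 <= step_pow N s.
Proof.
move=> s1 s0; have s11 : `|s| <= 1 by rewrite ler_norml s1; lra.
have Ns : 0 <= N%:R * - s by rewrite mulr_ge0//; lra.
have pos : 0 < 1 + N%:R * - s by lra.
apply: (@le_trans _ _ (1 + (2 ^ N)%:R * - ((1 + s) / 2) ^+ N)).
  rewrite [X in _ <= _ + X]mulrN two_pow lerD2l lerN2 -[leRHS]mul1r ler_pdivlMr//.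
  apply: (@le_trans _ _ ((1 + s) ^+ N * (1 - s) ^+ N)).
    by rewrite ler_wpM2l ?exprn_ge0 ?bernoulli_le//; lra.
  rewrite -exprMn exprn_ile1//; first by rewrite mulr_ge0//; lra.
  nra.
apply: bernoulli_le.
by have /andP[] := step_pow_base N s11; lra.
Qed.

Lemma step_pow_pos N s : 0 <= s -> s <= 1 -> step_pow N s <= (1 + N%:R * s)^-1.
Proof.
move=> s0 s1; have s11 : `|s| <= 1 by rewrite ler_norml; lra.
have Ns : 0 <= N%:R * s by rewrite mulr_ge0//; lra.
have pos : 0 < 1 + N%:R * s by lra.
have /andP[h0 h1] := step_pow_base N s11.
have /andP[q0 q1] := step_pow_01 N s11.
rewrite -[leRHS]mul1r ler_pdivlMr//.
set y := ((1 + s) / 2) ^+ N in h0 h1.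
have y0 : 0 <= y by lra.
apply: (@le_trans _ _ (step_pow N s * (1 + y) ^+ (2 ^ N))).
  rewrite ler_wpM2l//; apply: (@le_trans _ _ (1 + (2 ^ N)%:R * y)).
    rewrite lerD2l two_pow; apply: le_trans (bernoulli_le _ _); lra.
  by apply: bernoulli_le; lra.
rewrite /step_pow -/y -exprMn exprn_ile1//; first by rewrite mulr_ge0//; lra.
nra.
Qed.

Lemma sin_ge_linear x : 0 <= x <= 1 -> cos 1 * x <= sin x.
Proof.
move=> /andP[x0 x1].
move: x0; rewrite le_eqVlt => /predU1P[<-|x0]; first by rewrite mulr0 sin0.
have [c + e] : exists2 c, c \in `]0, x[ & sin x - sin 0 = cos c * (x - 0).
  apply: MVT => //.
  by apply: continuous_subspaceT; exact: continuous_sin.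
rewrite in_itv/= => /andP[c0 cx].
move: e; rewrite sin0 !subr0 => ->.
rewrite ler_wpM2r// ?(ltW x0)//.
have c1 : c < 1 by apply: lt_le_trans x1.
have p1 : (1 : R) <= pi by apply: le_trans (@pi_ge2 R); lra.
by rewrite ltW// ltr_cos// in_itv/= ?ler01// (ltW c0) (le_trans (ltW c1)).
Qed.

(** A trigonometric polynomial in [v] that stays in [0, 1] and approximates the
    indicator of [v <= b]. The frequency [1 / n.+1] tends to 0, so that any given
    [v] is eventually within a quarter of a period from [b]; the shift of the
    jump to [b + 1 / n.+1] puts [v = b] on the left of the jump; and the exponent
    [n.+1 ^ 3] outweighs the value of the sine, which is at least of the order
    of [1 / n.+1 ^ 2]. *)
Definition step_fun b n v : R :=
  step_pow (n.+1 ^ 3) (sin ((v - b - n.+1%:R^-1) / n.+1%:R)).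

Lemma step_fun_01 b n v : 0 <= step_fun b n v <= 1.
Proof. by apply: step_pow_01; exact: sin_max. Qed.

Lemma step_fun_cvg b v : step_fun b n v @[n --> \oo] --> ((v <= b)%R%:R : R).
Proof.
have c0 := @cos1_gt0 R.
apply/cvgrPdist_le => e e0.
(* [rb] and [rv] put the argument of the sine between 1 / r ^ 2 and 1 in absolute
   value, on the side of the jump where [v] lies *)
near=> n.
pose r : R := n.+1%:R.
have r0 : 0 < r by rewrite ltr0n.
have re : (1 + r * cos 1)^-1 <= e.
  rewrite -[leRHS]invrK lef_pV2 ?posrE ?invr_gt0//; last by rewrite addr_gt0// mulr_gt0.
  apply: (@le_trans _ _ (r * cos 1)); last by rewrite lerDr.
  rewrite -ler_pdivrMr// /r; near: n.
  exists (Num.truncn (e^-1 / cos 1)) => // n /= nn.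
  by apply/ltW/(lt_le_trans (truncnS_gt _)); rewrite ler_nat ltnS.
have rb : `|v - b| + 1 <= r.
  rewrite /r; near: n.
  exists (Num.truncn (`|v - b| + 1)) => // n /= nn.
  by apply/ltW/(lt_le_trans (truncnS_gt _)); rewrite ler_nat ltnS.
have rv : 2 / `|v - b| <= r.
  rewrite /r; near: n.
  exists (Num.truncn (2 / `|v - b|)) => // n /= nn.
  by apply/ltW/(lt_le_trans (truncnS_gt _)); rewrite ler_nat ltnS.
have ri : r^-1 <= 1 by rewrite invf_le1// ler1n.
have ri0 : 0 < r^-1 by rewrite invr_gt0.
have N3 : (n.+1 ^ 3)%:R = r ^+ 3 by rewrite natrX.
have finish s : r^-1 / r <= s -> s <= 1 -> (1 + (n.+1 ^ 3)%:R * sin s)^-1 <= e.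
  move=> rs s1; apply: le_trans re.
  have s0 : 0 < s by apply: lt_le_trans rs; rewrite mulr_gt0.
  have sins : cos 1 * s <= sin s by apply: sin_ge_linear; rewrite s1 ltW.
  have h : r * cos 1 <= (n.+1 ^ 3)%:R * sin s.
    apply: (@le_trans _ _ (r ^+ 3 * (cos 1 * s))); last by rewrite N3 ler_wpM2l// exprn_ge0// ltW.
    rewrite (_ : r * cos 1 = r ^+ 3 * (cos 1 * (r^-1 / r))); last first.
      by field; rewrite gt_eqF.
    by rewrite ler_wpM2l ?exprn_ge0 ?(ltW r0)// ler_wpM2l// ltW.
  rewrite lef_pV2 ?posrE ?lerD2l//; last by rewrite addr_gt0// mulr_gt0.
  by rewrite addr_gt0// (lt_le_trans _ h)// mulr_gt0.
have /andP[q0 q1] := step_fun_01 b n v.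
move: q0 q1; rewrite /step_fun -/r; clearbody r => q0 q1.
set s := (v - b - r^-1) / r.
have := ler_norm (v - b); have := ler_norm (- (v - b)); rewrite normrN => nb1 nb2.
have [vb|bv] := leP v b.
  rewrite ger0_norm ?subr_ge0//.
  have rs : r^-1 / r <= - s.
    by rewrite /s -mulNr ler_pM2r ?invr_gt0//; lra.
  have s1 : - s <= 1 by rewrite /s -mulNr ler_pdivrMr// mul1r; lra.
  have sinN0 : 0 <= - sin s.
    rewrite -sinN; apply: le_trans (sin_ge_linear _).
      by rewrite mulr_ge0 ?(ltW c0)// (le_trans _ rs)// mulr_ge0 ?ltW.
    by rewrite s1 (le_trans _ rs)// mulr_ge0 ?ltW.
  have := finish _ rs s1; rewrite sinN => fin.
  rewrite lerBlDr -lerBlDl; apply: le_trans (step_pow_neg _ _ _); last 2 first.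
  - exact: sin_geN1.
  - by rewrite -/s; lra.
  by rewrite lerD2l lerN2.
rewrite add0r normrN ger0_norm//.
have rs : r^-1 / r <= s.
  rewrite /s ler_pM2r ?invr_gt0//.
  have : r^-1 *+ 2 <= v - b.
    rewrite -mulr_natl ler_pdivrMr// mulrC -ler_pdivrMr ?subr_gt0//.
    by move: rv; rewrite ger0_norm// subr_ge0 ltW.
  rewrite mulr2n; lra.
have s1 : s <= 1 by rewrite /s ler_pdivrMr// mul1r; lra.
apply: le_trans (finish _ rs s1).
apply: step_pow_pos; last exact: sin_le1.
apply: le_trans (sin_ge_linear _); last by rewrite s1 (le_trans _ rs)// mulr_ge0 ?ltW.
by rewrite mulr_ge0 ?(ltW c0)// (le_trans _ rs)// mulr_ge0 ?ltW.
Unshelve. all: end_near. Qed.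

End trigonometric_step.

(** * From trigonometric test functions to half-lines *)

Section bounded_expectation.
Context d (T : measurableType d) {R : realType} (P : probability T R).
Implicit Types (f g H V : T -> R).

(** All expectations used for independence are of bounded measurable functions,
    for which linearity needs no further integrability condition. *)
Definition bounded_measurable f :=
  measurable_fun setT f /\ exists C : R, forall w, `|f w| <= C.

Notation bm := bounded_measurable.
Notation E f := (\int[P]_w f w)%R.

Lemma bmeas_cst (k : R) : bm (cst k).
Proof. by split=> //; exists `|k|. Qed.

Lemma bmeasM f g : bm f -> bm g -> bm (fun w => f w * g w).
Proof.
move=> [mf [C fC]] [mg [D gD]]; split; first exact: measurable_funM.
by exists (C * D) => w; rewrite normrM ler_pM.
Qed.

Lemma bmeasD f g : bm f -> bm g -> bm (fun w => f w + g w).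
Proof.
move=> [mf [C fC]] [mg [D gD]]; split; first exact: measurable_funD.
by exists (C + D) => w; rewrite (le_trans (ler_normD _ _))// lerD.
Qed.

Lemma bmeasZ (k : R) f : bm f -> bm (fun w => k * f w).
Proof. by move=> bf; apply: bmeasM => //; exact: bmeas_cst. Qed.

Lemma bmeasB f g : bm f -> bm g -> bm (fun w => f w - g w).
Proof.
move=> bf bg; rewrite (_ : (fun w => f w - g w) = (fun w => f w + (-1) * g w)).
  by apply: bmeasD => //; exact: bmeasZ.
by apply/funext => w; rewrite mulN1r.
Qed.

Lemma bmeas_cos V : measurable_fun setT V -> bm (fun w => cos (V w)).
Proof.
move=> mV; split; last by exists 1 => w; exact: cos_max.
by apply: measurableT_comp => //; apply: continuous_measurable_fun; exact: continuous_cos.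
Qed.

Lemma bmeas_bool (b : T -> bool) : measurable_fun setT b -> bm (fun w => (b w)%:R).
Proof.
move=> mb; split; last by exists 1 => w; case: (b w); rewrite ?normr1 ?normr0.
rewrite (_ : (fun w => (b w)%:R) = (fun w => if b w then 1 else 0 : R)).
  exact: measurable_fun_ifT.
by apply/funext => w; case: (b w).
Qed.

Lemma bmeas_integrable f : bm f -> P.-integrable setT (EFin \o f).
Proof.
move=> [mf [C fC]]; apply: measurable_bounded_integrable => //.
  by rewrite -ge0_fin_numE ?fin_num_measure.
exists C; split; first exact: num_real.
by move=> x Cx w _; rewrite /= (le_trans (fC w))// ltW.
Qed.

Lemma ExD f g : bm f -> bm g -> E (fun w => f w + g w) = E f + E g.
Proof. by move=> bf bg; rewrite RintegralD//; exact: bmeas_integrable. Qed.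

Lemma ExZ k f : bm f -> E (fun w => k * f w) = k * E f.
Proof. by move=> bf; rewrite RintegralZl//; exact: bmeas_integrable. Qed.

Lemma ExB f g : bm f -> bm g -> E (fun w => f w - g w) = E f - E g.
Proof. by move=> bf bg; rewrite RintegralB//; exact: bmeas_integrable. Qed.

Lemma Ex_cst k : E (cst k) = k.
Proof. by rewrite Rintegral_cst//= probability_setT mulr1. Qed.

Lemma Ex_bool (b : T -> bool) : measurable_fun setT b ->
  E (fun w => (b w)%:R) = fine (P [set w | b w]).
Proof.
move=> mb; rewrite /Rintegral; congr fine.
have mS : measurable [set w | b w].
  by rewrite -[X in measurable X]setTI; apply: mb.
rewrite -(setIT [set w | b w]) -integral_indic//; apply: eq_integral => w _.
rewrite indicE; congr (_%:R%:E)%E; case: (boolP (b w)) => bw.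
  by rewrite mem_set.
by rewrite memNset//=; exact/negP.
Qed.

Lemma bmeas_sum (I : Type) (r : seq I) (f : I -> T -> R) :
  (forall i, bm (f i)) -> bm (fun w => \sum_(i <- r) f i w).
Proof.
move=> bf; elim: r => [|i r IH].
  by rewrite (_ : (fun w => _) = cst 0); [exact: bmeas_cst|apply/funext => w; rewrite big_nil].
rewrite (_ : (fun w => _) = (fun w => f i w + \sum_(i <- r) f i w)).
  exact: bmeasD.
by apply/funext => w; rewrite big_cons.
Qed.

Lemma Ex_sum (I : Type) (r : seq I) (f : I -> T -> R) : (forall i, bm (f i)) ->
  E (fun w => \sum_(i <- r) f i w) = \sum_(i <- r) E (f i).
Proof.
move=> bf; elim: r => [|i r IH].
  rewrite big_nil -[RHS](Ex_cst 0); apply: eq_Rintegral => w _.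
  by rewrite big_nil.
rewrite big_cons -IH -ExD//; last exact: bmeas_sum.
by apply: eq_Rintegral => w _; rewrite big_cons.
Qed.

Lemma Ex_le (f g : T -> R) : bm f -> bm g -> (forall w, f w <= g w) -> E f <= E g.
Proof.
move=> bf bg fg; apply: le_Rintegral => //; try exact: bmeas_integrable.
Qed.

Lemma Ex_ge0 (f : T -> R) : (forall w, 0 <= f w) -> 0 <= E f.
Proof. by move=> f0; apply: Rintegral_ge0. Qed.

(** [H] is orthogonal to all trigonometric functions of [V], hence also to
    the indicators of the half-lines of [V]. *)
Definition trig_null H V := forall t c, E (fun w => H w * cos (t * V w + c)) = 0.

(** Orthogonality to trigonometric functions survives multiplication of [H] by a
    trigonometric polynomial in [V], since a product of two cosines is a sum of
    cosines. *)
Lemma trig_null_mulcos H V (a b k c : R) :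
  bm H -> measurable_fun setT V -> trig_null H V ->
  trig_null (fun w => H w * (a + b * cos (k * V w + c))) V.
Proof.
move=> bH mV HV t c'.
have bc u e : bm (fun w => H w * cos (u * V w + e)).
  apply: bmeasM => //; apply: bmeas_cos.
  by apply: measurable_funD => //; apply: measurable_funM.
transitivity (E (fun w => a * (H w * cos (t * V w + c')) +
   (b / 2 * (H w * cos ((t + k) * V w + (c' + c))) +
    b / 2 * (H w * cos ((t - k) * V w + (c' - c)))))).
  apply: eq_Rintegral => w _.
  rewrite (_ : (t + k) * V w + (c' + c) = (t * V w + c') + (k * V w + c)); last by ring.
  rewrite (_ : (t - k) * V w + (c' - c) = (t * V w + c') - (k * V w + c)); last by ring.
  by move: (t * V w + c') (k * V w + c) => A B; rewrite cosD cosB; field.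
rewrite ExD ?ExD ?ExZ ?HV ?mulr0 ?addr0//; try exact: bmeasZ.
by apply: bmeasD; exact: bmeasZ.
Qed.

Lemma trig_null_step_pow H V (N : nat) (k c : R) :
  bm H -> measurable_fun setT V -> trig_null H V ->
  trig_null (fun w => H w * step_pow N (cos (k * V w + c))) V.
Proof.
move=> bH mV HV.
have by_ : bm (fun w => (1 + cos (k * V w + c)) / 2).
  rewrite (_ : (fun w => _) = (fun w => 2^-1 + 2^-1 * cos (k * V w + c))).
    apply: bmeasD; first exact: bmeas_cst.
    apply: bmeasZ; apply: bmeas_cos.
    by apply: measurable_funD => //; apply: measurable_funM.
  by apply/funext => w; field.
have bX f j : bm f -> bm (fun w => f w ^+ j).
  move=> bf; elim: j => [|j IH].
    by rewrite (_ : (fun w => _) = cst 1); [exact: bmeas_cst|apply/funext => w; rewrite expr0].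
  rewrite (_ : (fun w => _) = (fun w => f w * f w ^+ j)); first exact: bmeasM.
  by apply/funext => w; rewrite exprS.
have powy j : forall G, bm G -> trig_null G V ->
    trig_null (fun w => G w * ((1 + cos (k * V w + c)) / 2) ^+ j) V.
  elim: j => [|j IH] G bG GV.
    by rewrite (_ : (fun w => _) = G)//; apply/funext => w; rewrite expr0 mulr1.
  have bG' : bm (fun w => G w * ((1 + cos (k * V w + c)) / 2)) by exact: bmeasM.
  have := IH _ bG' _.
  rewrite (_ : (fun w => G w * ((1 + cos (k * V w + c)) / 2) *
                         ((1 + cos (k * V w + c)) / 2) ^+ j) =
    (fun w => G w * ((1 + cos (k * V w + c)) / 2) ^+ j.+1)); last first.
    by apply/funext => w; rewrite exprS [RHS]mulrA.
  apply; have := @trig_null_mulcos G V 2^-1 2^-1 k c bG mV GV.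
  rewrite (_ : (fun w => G w * (2^-1 + _)) = (fun w => G w * ((1 + cos (k * V w + c)) / 2)))//.
  by apply/funext => w; congr (_ * _); field.
rewrite /step_pow; elim: (2 ^ N)%N => [|j IH].
  by rewrite (_ : (fun w => _) = H)//; apply/funext => w; rewrite expr0 mulr1.
have bG : bm (fun w => H w * (1 - ((1 + cos (k * V w + c)) / 2) ^+ N) ^+ j).
  apply: bmeasM => //; apply: (bX); apply: bmeasB; [exact: bmeas_cst|exact: bX].
move=> t e.
have bc G : bm G -> bm (fun w => G w * cos (t * V w + e)).
  move=> bG'; apply: bmeasM => //; apply: bmeas_cos.
  by apply: measurable_funD => //; apply: measurable_funM.
have := powy N _ bG IH t e; have := IH t e.
set G := (fun w => H w * _) in bG *.
move=> G1 G2.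
transitivity (E (fun w => G w * cos (t * V w + e) -
   G w * ((1 + cos (k * V w + c)) / 2) ^+ N * cos (t * V w + e))).
  by apply: eq_Rintegral => w _; rewrite /G exprS; ring.
rewrite ExB ?G1 ?G2 ?subrr//; first exact: bc.
by apply: bc; apply: bmeasM => //; exact: bX.
Qed.

Lemma Ex_mul_step H V b n : bm H -> measurable_fun setT V -> trig_null H V ->
  E (fun w => H w * step_fun b n (V w)) = 0.
Proof.
move=> bH mV HV.
have := @trig_null_step_pow H V (n.+1 ^ 3) (n.+1%:R^-1)
  ((- b - n.+1%:R^-1) / n.+1%:R - pi / 2) bH mV HV 0 0.
move=> h; rewrite -[RHS]h; apply: eq_Rintegral => w _.
rewrite mul0r add0r cos0 mulr1 /step_fun; congr (_ * step_pow _ _).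
(* the sine is a cosine with phase [- pi / 2] *)
rewrite addrA cosBpihalf; congr sin; ring.
Qed.

(** The indicator of [V <= b] is a bounded pointwise limit of trigonometric
    polynomials in [V]; conclude by dominated convergence. *)
Lemma Ex_mul_le H V b : bm H -> measurable_fun setT V -> trig_null H V ->
  E (fun w => H w * (V w <= b)%R%:R) = 0.
Proof.
move=> bH mV HV.
have [mH [C HC]] := bH.
have ms n : measurable_fun setT (fun w => step_fun b n (V w)).
  rewrite /step_fun /step_pow; apply: measurable_funX; apply: measurable_funB => //.
  apply: measurable_funX; apply: measurable_funM => //; apply: measurable_funD => //.
  apply: measurableT_comp; first by apply: continuous_measurable_fun; exact: continuous_sin.
  by apply: measurable_funM => //; do 2 apply: measurable_funB => //.
have cvg1 : (\int[P]_w (H w * step_fun b n (V w))%:E)%E @[n --> \oo] -->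
    (\int[P]_w (H w * (V w <= b)%R%:R)%:E)%E.
  apply: (@dominated_cvg _ _ _ P setT _ (fun n w => (H w * step_fun b n (V w))%:E) _
     (fun=> C%:E)) => //.
  - by move=> n; apply/measurable_EFinP; exact: measurable_funM.
  - move=> w _; apply: cvg_EFin; first exact: nearW.
    by apply: cvgM; [exact: cvg_cst|exact: step_fun_cvg].
  - exact: finite_measure_integrable_cst.
  - move=> n w _; rewrite lee_fin normrM -[leRHS]mulr1.
    have /andP[s0 s1] := step_fun_01 b n (V w).
    by rewrite ler_pM// ger0_norm.
have cvg0 : (\int[P]_w (H w * step_fun b n (V w))%:E)%E @[n --> \oo] --> 0%:E.
  apply: cvg_near_cst; apply: nearW => n.
  rewrite -(Ex_mul_step b n bH mV HV) /Rintegral fineK//.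
  apply: integrable_fin_num => //.
  apply: (le_integrable measurableT _ _ (bmeas_integrable bH)).
    by apply/measurable_EFinP; exact: measurable_funM.
  move=> w _; rewrite lee_fin normrM -[leRHS]mulr1.
  have /andP[s0 s1] := step_fun_01 b n (V w).
  by rewrite ler_pM// ger0_norm.
by rewrite /Rintegral -(cvg_unique _ cvg0 cvg1).
Qed.

Lemma Ex_mul_lteif H V b s : bm H -> measurable_fun setT V -> trig_null H V ->
  E (fun w => H w * (V w < b ?<= if s)%R%:R) = 0.
Proof.
move=> bH mV HV; case: s => /=; first exact: Ex_mul_le.
(* a strict half-line of [V] is the complement of a closed half-line of [- V] *)
have mN : measurable_fun setT (fun w => - V w) by exact: measurableT_comp.
have nN : trig_null H (fun w => - V w).
  move=> t c; rewrite -(HV (- t) c); apply: eq_Rintegral => w _.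
  by rewrite mulrN mulNr.
have := Ex_mul_le (- b) bH mN nN.
have H0 : E H = 0.
  by rewrite -(HV 0 0); apply: eq_Rintegral => w _; rewrite mul0r add0r cos0 mulr1.
move=> h; transitivity (E (fun w => H w - H w * (- V w <= - b)%R%:R)).
  apply: eq_Rintegral => w _; rewrite lerN2 real_leNgt ?num_real//.
  by case: (V w < b); rewrite ?mulr1 ?mulr0 ?subr0 ?subrr.
rewrite ExB ?h ?H0 ?subrr//; apply: bmeasM => //; apply: bmeas_bool.
exact: measurable_fun_ler.
Qed.

End bounded_expectation.

(** * Gaussian random variables *)

Section gaussian_variable.
Context d (T : measurableType d) {R : realType} (P : probability T R).
Notation mu := (@lebesgue_measure R).
Notation E f := (\int[P]_w f w)%R.

Definition gaussian_rv (U : T -> R) (m s : R) :=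
  measurable_fun setT U /\
  forall A : set R, measurable A -> pushforward P U A = gaussian_law m s A.

(** Change of variables along [U]. The target is [measurableTypeR R], the space on
    which [normal_prob] is a measure. *)
Lemma integral_law (nu : {measure set (measurableTypeR R) -> \bar R})
    (U : T -> measurableTypeR R) (f : measurableTypeR R -> R) :
  measurable_fun setT U ->
  (forall A : set (measurableTypeR R), measurable A -> P (U @^-1` A) = nu A) ->
  measurable_fun setT f -> nu.-integrable setT (EFin \o f) ->
  P.-integrable setT (EFin \o (fun w => f (U w))) /\
  E (fun w => f (U w)) = \int[nu]_x f x.
Proof.
move=> mU law mf /integrableP[mEf fin].
pose pU : {mfun T >-> measurableTypeR R} := HB.pack U (isMeasurableFun.Build _ _ _ _ U mU).
have int : P.-integrable setT ((EFin \o f) \o U).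
  apply/integrableP; split; first exact: measurableT_comp.
  rewrite -[X in integral P X](preimage_setT U).
  have mabs : measurable_fun setT (abse \o (EFin \o f)) by exact: measurableT_comp.
  rewrite -(ge0_integral_pushforward mU P (f := abse \o (EFin \o f)))//; last first.
    by move=> y _; exact: abse_ge0.
  apply: le_lt_trans fin; rewrite le_eqVlt; apply/orP; left; apply/eqP.
  apply: (@eq_measure_integral _ _ R setT nu (pushforward P pU)).
  by move=> A mA _; exact: law.
split=> //.
rewrite /Rintegral; congr fine.
rewrite -[X in integral P X](preimage_setT U) -[LHS](integral_pushforward mU mEf)//.
apply: (@eq_measure_integral _ _ R setT nu (pushforward P pU)).
by move=> A mA _; exact: law.
Qed.

Lemma gaussian_rv_Rintegral U m s (f : R -> R) : gaussian_rv U m s -> s != 0 ->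
  measurable_fun setT f -> (forall x, `|f x| <= 1 + (x - m) ^+ 2) ->
  P.-integrable setT (EFin \o (fun w => f (U w))) /\
  E (fun w => f (U w)) = \int[mu]_x (f x * normal_pdf m s x).
Proof.
move=> [mU lawU] s0 mf fle.
have fi := integrable_normal_pdf_mul s0 mf fle.
rewrite -(Rintegral_normal_prob mf fi).
have law (A : set (measurableTypeR R)) : measurable A ->
    P (U @^-1` A) = normal_prob m s A.
  by move=> mA; rewrite -[LHS]/(pushforward P U A) lawU// /gaussian_law (negbTE s0).
exact: (integral_law mU law mf (integrable_normal_prob mf fi)).
Qed.

Lemma degenerate_gaussian_rv_Rintegral U m (f : R -> R) : gaussian_rv U m 0 ->
  measurable_fun setT f ->
  P.-integrable setT (EFin \o (fun w => f (U w))) /\ E (fun w => f (U w)) = f m.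
Proof.
move=> [mU lawU] mf.
pose nu : {measure set (measurableTypeR R) -> \bar R} := @dirac _ (measurableTypeR R) m R.
have law (A : set (measurableTypeR R)) : measurable A -> P (U @^-1` A) = nu A.
  by move=> mA; rewrite -[LHS]/(pushforward P U A) lawU// /gaussian_law eqxx.
have mEf : measurable_fun setT (EFin \o f) by exact/measurable_EFinP.
have int : nu.-integrable setT (EFin \o f).
  apply/integrableP; split => //.
  rewrite /nu integral_dirac//; last exact: measurableT_comp.
  by rewrite diracT mul1e ltry.
have [-> ->] := integral_law mU law mf int; split=> //.
by rewrite /Rintegral /nu integral_dirac// diracT mul1e.
Qed.

(** The growth condition of [gaussian_rv_Rintegral] for the first moment. *)
Lemma center_le_sqr (x m : R) : `|x - m| <= 1 + (x - m) ^+ 2.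
Proof. rewrite -(real_normK (num_real (x - m))); have := normr_ge0 (x - m); nra. Qed.

Lemma gaussian_rv_mean U m s : gaussian_rv U m s ->
  P.-integrable setT (EFin \o U) /\ E U = m.
Proof.
move=> gU.
have mf : measurable_fun setT (fun x : R => x - m) by exact: measurable_funB.
have [s0|s0] := eqVneq s 0.
  rewrite s0 in gU.
  by have := degenerate_gaussian_rv_Rintegral (f := id) gU (@measurable_id _ _ _).
have [ci cE] := gaussian_rv_Rintegral gU s0 mf (center_le_sqr ^~ m).
have mi : P.-integrable setT (EFin \o cst m) by exact: finite_measure_integrable_cst.
have iU : P.-integrable setT (EFin \o U).
  have := integrableD measurableT ci mi; apply: eq_integrable => // w _ /=.
  by rewrite -EFinD subrK.
split=> //; move: cE; rewrite RintegralB// Rintegral_normal_mean//.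
rewrite Rintegral_cst// [X in _ * fine X](_ : _ = 1%E); last exact: probability_setT.
by rewrite mulr1 => /eqP; rewrite subr_eq0 => /eqP.
Qed.

Lemma gaussian_rv_variance U s : gaussian_rv U 0 s ->
  P.-integrable setT (EFin \o (fun w => U w ^+ 2)) /\ E (fun w => U w ^+ 2) = s ^+ 2.
Proof.
move=> gU; have mf : measurable_fun setT (fun x : R => x ^+ 2) by exact: measurable_funX.
have [s0|s0] := eqVneq s 0.
  by rewrite s0 in gU *; have := degenerate_gaussian_rv_Rintegral gU mf.
have [|i ->] := gaussian_rv_Rintegral gU s0 mf.
  by move=> x; rewrite subr0 ger0_norm ?sqr_ge0// lerDr.
split=> //; rewrite -[RHS](Rintegral_normal_variance 0 s0).
by apply: eq_Rintegral => x _; rewrite subr0.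
Qed.

Lemma gaussian_rv_cos U s c : gaussian_rv U 0 s ->
  E (fun w => cos (U w + c)) = cos c * expR (- s ^+ 2 / 2).
Proof.
move=> gU; have mf : measurable_fun setT (fun x : R => cos (x + c)).
  apply: measurableT_comp; last exact: measurable_funD.
  by apply: continuous_measurable_fun; exact: continuous_cos.
have [s0|s0] := eqVneq s 0.
  rewrite s0 in gU *; have [_ ->] := degenerate_gaussian_rv_Rintegral gU mf.
  by rewrite add0r expr0n/= oppr0 mul0r expR0 mulr1.
have [|_ ->] := gaussian_rv_Rintegral gU s0 mf.
  by move=> x; rewrite (le_trans (cos_max _))// lerDl sqr_ge0.
exact: Rintegral_cos_normal.
Qed.

End gaussian_variable.

(** * Uncorrelated Gaussian vectors are independent *)

Section gaussian_family.
Context d (T : measurableType d) {R : realType} (P : probability T R) (p : nat).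
Variable Y : 'I_p -> T -> R.
Notation E f := (\int[P]_w f w)%R.
Notation bm := bounded_measurable.
Implicit Types (a b z : 'rV[R]_p).

Definition lin a w : R := \sum_k a 0 k * Y k w.

Hypothesis gaussY : forall a, exists2 s, 0 <= s & gaussian_rv P (lin a) 0 s.

Lemma linD a b w : lin (a + b) w = lin a w + lin b w.
Proof. by rewrite /lin -big_split; apply: eq_bigr => k _; rewrite mxE mulrDl. Qed.

Lemma linZ (k : R) a w : lin (k *: a) w = k * lin a w.
Proof. by rewrite /lin mulr_sumr; apply: eq_bigr => i _; rewrite mxE mulrA. Qed.

Lemma lin0 w : lin 0 w = 0.
Proof. by rewrite -(scale0r 0) linZ mul0r. Qed.

Lemma linN a w : lin (- a) w = - lin a w.
Proof. by rewrite -scaleN1r linZ mulN1r. Qed.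

Lemma linB a b w : lin (a - b) w = lin a w - lin b w.
Proof. by rewrite linD linN. Qed.

Lemma measurable_lin a : measurable_fun setT (lin a).
Proof. by have [s _ []] := gaussY a. Qed.

(** The covariance of two linear combinations when all of them are centered. *)
Definition cov a b : R := E (fun w => lin a w * lin b w).

Lemma integrable_lin2 a b : P.-integrable setT (EFin \o (fun w => lin a w * lin b w)).
Proof.
have [s _ /gaussian_rv_variance[ia _]] := gaussY a.
have [t _ /gaussian_rv_variance[ib _]] := gaussY b.
apply: (le_integrable measurableT _ _ (integrableD measurableT ia ib)).
  by apply/measurable_EFinP; apply: measurable_funM; exact: measurable_lin.
move=> w _ /=; rewrite lee_fin [leRHS]ger0_norm ?addr_ge0 ?sqr_ge0// ler_norml.
apply/andP; split; nra.
Qed.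

Lemma covC a b : cov a b = cov b a.
Proof. by apply: eq_Rintegral => w _; rewrite mulrC. Qed.

Lemma covDl a b z : cov (a + b) z = cov a z + cov b z.
Proof.
rewrite /cov -RintegralD//; try exact: integrable_lin2.
by apply: eq_Rintegral => w _; rewrite linD mulrDl.
Qed.

Lemma covZl k a z : cov (k *: a) z = k * cov a z.
Proof.
rewrite /cov -RintegralZl//; last exact: integrable_lin2.
by apply: eq_Rintegral => w _; rewrite linZ mulrA.
Qed.

Lemma covDr a b z : cov z (a + b) = cov z a + cov z b.
Proof. by rewrite ![cov z _]covC covDl. Qed.

Lemma covZr k a z : cov z (k *: a) = k * cov z a.
Proof. by rewrite ![cov z _]covC covZl. Qed.

Lemma covNr a z : cov z (- a) = - cov z a.
Proof. by rewrite -scaleN1r covZr mulN1r. Qed.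

Lemma covBr a b z : cov z (a - b) = cov z a - cov z b.
Proof. by rewrite covDr covNr. Qed.

Lemma cov0r z : cov z 0 = 0.
Proof. by rewrite -(scale0r 0) covZr mul0r. Qed.

Lemma cov_ge0 a : 0 <= cov a a.
Proof. by apply: Rintegral_ge0 => w _; rewrite -expr2 sqr_ge0. Qed.

Lemma covBB a b : cov (a - b) (a - b) = cov a a - 2 * cov a b + cov b b.
Proof. by rewrite covBr covC (covC _ b) !covBr (covC b a); ring. Qed.

Lemma covDD a b : cov (a + b) (a + b) = cov a a + 2 * cov a b + cov b b.
Proof. by rewrite covDr covC (covC _ b) !covDr (covC b a); ring. Qed.

Lemma lin_gaussian_rv a : gaussian_rv P (lin a) 0 (Num.sqrt (cov a a)).
Proof.
have [s s0 gs] := gaussY a; have [_ v] := gaussian_rv_variance gs.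
have -> : cov a a = s ^+ 2.
  by rewrite -v; apply: eq_Rintegral => w _; rewrite expr2.
by rewrite sqrtr_sqr ger0_norm.
Qed.

Lemma Ex_cos_lin a c : E (fun w => cos (lin a w + c)) = cos c * expR (- cov a a / 2).
Proof.
have [s _ gs] := gaussY a; have [_ v] := gaussian_rv_variance gs.
rewrite (gaussian_rv_cos c gs) -v; congr (_ * expR (- _ / 2)).
Qed.

Lemma bmeas_cos_lin a c : bm (fun w => cos (lin a w + c)).
Proof.
by apply: bmeas_cos; apply: measurable_funD => //; exact: measurable_lin.
Qed.

(** Both sides are computed from the characteristic function of single linear
    combinations: the product of cosines is half the sum of the cosines of
    [lin (a + b)] and [lin (a - b)], both of which have variance
    [cov a a + cov b b]. *)
Lemma Ex_cos_lin2 a b c c' : cov a b = 0 ->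
  E (fun w => cos (lin a w + c) * cos (lin b w + c')) =
  E (fun w => cos (lin a w + c)) * E (fun w => cos (lin b w + c')).
Proof.
move=> ab.
transitivity (E (fun w => 2^-1 * cos (lin (a + b) w + (c + c')) +
    2^-1 * cos (lin (a - b) w + (c - c')))).
  apply: eq_Rintegral => w _.
  rewrite (_ : lin (a + b) w + (c + c') = (lin a w + c) + (lin b w + c')); last first.
    by rewrite linD; ring.
  rewrite (_ : lin (a - b) w + (c - c') = (lin a w + c) - (lin b w + c')); last first.
    by rewrite linB; ring.
  by move: (lin a w + c) (lin b w + c') => A B; rewrite cosD cosB; field.
rewrite ExD; [|by apply: bmeasZ; exact: bmeas_cos_lin..].
rewrite !ExZ; try exact: bmeas_cos_lin.
rewrite !Ex_cos_lin covDD covBB ab mulr0 subr0 addr0 cosD cosB.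
rewrite (_ : - (cov a a + cov b b) / 2 = (- cov a a) / 2 + (- cov b b) / 2); last by field.
by rewrite expRD; field.
Qed.

(** A normal vector, a bound, and whether the inequality is large; the strict
    inequalities are needed to break ties between equal coordinates. *)
Definition half_space := ('rV[R]_p * R * bool)%type.

Definition in_half_space w (h : half_space) : bool :=
  (lin h.1.1 w < h.1.2 ?<= if h.2)%R.

Definition in_polytope (hs : seq half_space) w : bool := all (in_half_space w) hs.

Lemma measurable_in_half_space h : measurable_fun setT (in_half_space ^~ h).
Proof.
rewrite /in_half_space; case: h.2 => /=.
  by apply: measurable_fun_ler => //; exact: measurable_lin.
by apply: measurable_fun_ltr => //; exact: measurable_lin.
Qed.

Lemma measurable_in_polytope hs : measurable_fun setT (in_polytope hs).
Proof.
elim: hs => [|h hs IH]; first exact: measurable_cst.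
exact: measurable_and (measurable_in_half_space h) IH.
Qed.

(** Factorization for mixed test functions: indicators of half-spaces for the
    combinations listed in [hs], a cosine for one further combination [b].
    By induction on [hs], for all [b] at once: the induction hypothesis, applied
    to [b] plus or minus multiples of the normal vector of a half-space, says
    exactly that the remaining factors are orthogonal to all trigonometric
    functions of the corresponding combination, and [Ex_mul_lteif] replaces these
    by the indicator of the half-space. *)
Lemma Ex_cos_polytope a t c : forall hs : seq half_space,
  (forall h, h \in hs -> cov a h.1.1 = 0) -> forall b c', cov a b = 0 ->
  E (fun w => (cos (t * lin a w + c) - E (fun w => cos (t * lin a w + c))) *
    (in_polytope hs w)%:R * cos (lin b w + c')) = 0.
Proof.
set m := E _.
have bcos : bm (fun w => cos (t * lin a w + c)).
  apply: bmeas_cos; apply: measurable_funD => //; apply: measurable_funM => //.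
  exact: measurable_lin.
have bC : bm (fun w => cos (t * lin a w + c) - m).
  by apply: bmeasB => //; exact: bmeas_cst.
have bP hs : bm (fun w => (in_polytope hs w)%:R : R).
  by apply: bmeas_bool; exact: measurable_in_polytope.
elim=> [_|h hs IH hh] b c' ab.
  transitivity (E (fun w => cos (lin (t *: a) w + c) * cos (lin b w + c') -
     m * cos (lin b w + c'))).
    by apply: eq_Rintegral => w _; rewrite /= mulr1 mulrBl linZ.
  rewrite ExB; last 2 first.
  - by apply: bmeasM; exact: bmeas_cos_lin.
  - by apply: bmeasZ; exact: bmeas_cos_lin.
  rewrite Ex_cos_lin2 ?covZl ?ab ?mulr0// ExZ; last exact: bmeas_cos_lin.
  rewrite (_ : E (fun w => cos (lin (t *: a) w + c)) = m) ?subrr//.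
  by apply: eq_Rintegral => w _; rewrite linZ.
have ah : cov a h.1.1 = 0 by apply: hh; rewrite mem_head.
have {}IH := IH (fun h0 hin => hh h0 (mem_behead (s := h :: hs) hin)).
pose H w := (cos (t * lin a w + c) - m) * (in_polytope hs w)%:R * cos (lin b w + c').
have bH : bm H.
  by apply: bmeasM; [exact: bmeasM|exact: bmeas_cos_lin].
transitivity (E (fun w => H w * (lin h.1.1 w < h.1.2 ?<= if h.2)%R%:R)).
  apply: eq_Rintegral => w _; rewrite /H /= -mulnb natrM.
  by rewrite -/(in_half_space w h) -/(in_polytope hs w); ring.
apply: Ex_mul_lteif => //; first exact: measurable_lin.
move=> t1 c1; rewrite /H.
pose G w := (cos (t * lin a w + c) - m) * (in_polytope hs w)%:R.
transitivity (E (fun w => 2^-1 * (G w * cos (lin (b + t1 *: h.1.1) w + (c' + c1))) +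
    2^-1 * (G w * cos (lin (b - t1 *: h.1.1) w + (c' - c1))))).
  apply: eq_Rintegral => w _; rewrite -/(G w).
  rewrite (_ : lin (b + _) w + (c' + c1) = (lin b w + c') + (t1 * lin h.1.1 w + c1)); last first.
    by rewrite linD linZ; ring.
  rewrite (_ : lin (b - _) w + (c' - c1) = (lin b w + c') - (t1 * lin h.1.1 w + c1)); last first.
    by rewrite linB linZ; ring.
  by move: (G w) (lin b w + c') (t1 * lin h.1.1 w + c1) => g A B; rewrite cosD cosB; field.
have bG e e' : bm (fun w => G w * cos (lin e w + e')).
  by apply: bmeasM; [exact: bmeasM|exact: bmeas_cos_lin].
rewrite ExD; [|by apply: bmeasZ..].
by rewrite !ExZ// /G !IH ?mulr0 ?addr0// ?covBr ?covDr covZr ah ab ?mulr0 ?subr0 ?addr0.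
Qed.

(** [Ex_cos_polytope] with no cosine factor left for the polytope says that its
    centered indicator is orthogonal to the trigonometric functions of [lin a],
    hence to the indicators of half-lines of [lin a]. *)
Lemma polytope_indep a (u : R) s (hs : seq half_space) :
  (forall h, h \in hs -> cov a h.1.1 = 0) ->
  E (fun w => (in_polytope hs w)%:R * (lin a w < u ?<= if s)%R%:R) =
  E (fun w => (in_polytope hs w)%:R) * E (fun w => (lin a w < u ?<= if s)%R%:R).
Proof.
move=> hh.
have bP : bm (fun w => (in_polytope hs w)%:R : R).
  by apply: bmeas_bool; exact: measurable_in_polytope.
have mI : measurable_fun setT (fun w => (lin a w < u ?<= if s)%R).
  exact: (measurable_in_half_space (a, u, s)).
have bI := bmeas_bool mI.
set q := E (fun w => (in_polytope hs w)%:R).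
have bH : bm (fun w => (in_polytope hs w)%:R - q).
  by apply: bmeasB => //; exact: bmeas_cst.
have Hn : trig_null P (fun w => (in_polytope hs w)%:R - q) (lin a).
  move=> t c; have bcos : bm (fun w => cos (t * lin a w + c)).
    apply: bmeas_cos; apply: measurable_funD => //; apply: measurable_funM => //.
    exact: measurable_lin.
  have := @Ex_cos_polytope a t c hs hh 0 0 (cov0r a).
  set m := E (fun w => cos (t * lin a w + c)).
  under eq_Rintegral do rewrite lin0 add0r cos0 mulr1.
  rewrite (_ : Rintegral _ _ _ = E (fun w =>
      (in_polytope hs w)%:R * cos (t * lin a w + c) -
      m * (in_polytope hs w)%:R)); last first.
    by apply: eq_Rintegral => w _; ring.
  rewrite ExB ?ExZ//; [|exact: bmeasM|exact: bmeasZ].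
  move=> h; transitivity (E (fun w =>
      (in_polytope hs w)%:R * cos (t * lin a w + c) -
      q * cos (t * lin a w + c))).
    by apply: eq_Rintegral => w _; ring.
  rewrite ExB ?ExZ//; [|exact: bmeasM|exact: bmeasZ].
  by rewrite mulrC.
have := Ex_mul_lteif u s bH (measurable_lin a) Hn.
rewrite (_ : Rintegral _ _ _ = E (fun w =>
    (in_polytope hs w)%:R * (lin a w < u ?<= if s)%R%:R -
    q * (lin a w < u ?<= if s)%R%:R)); last first.
  by apply: eq_Rintegral => w _; rewrite mulrBl.
rewrite ExB ?ExZ//; [|exact: bmeasM|exact: bmeasZ].
by move/eqP; rewrite subr_eq0 => /eqP.
Qed.

End gaussian_family.

(** * Extrema over ordinals *)

Section extremal_ord.
Context {R : realType} (k : nat).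
Implicit Types f : 'I_k.+1 -> R.

Lemma le_max_ord f i : f i <= max_ord f.
Proof. by rewrite /max_ord; exact: le_bigmax. Qed.

Lemma max_ord_attained f : exists i, max_ord f = f i.
Proof.
rewrite /max_ord; elim/big_ind: _ => [|x y [i ->] [j ->]|i _]; [by exists ord0| |by exists i].
by case: (leP (f i) (f j)) => _; [exists j|exists i].
Qed.

Lemma min_ord_le f i : min_ord f <= f i.
Proof. by rewrite /min_ord; exact: bigmin_le. Qed.

Lemma min_ord_attained f : exists i, min_ord f = f i.
Proof.
rewrite /min_ord; elim/big_ind: _ => [|x y [i ->] [j ->]|i _]; [by exists ord0| |by exists i].
by case: (leP (f i) (f j)) => _; [exists i|exists j].
Qed.

(** Ties go to the smallest index, so that exactly one index qualifies. *)
Definition first_argmax f (j : 'I_k.+1) : bool :=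
  [forall i, f i < f j ?<= if (j <= i)%N].

Lemma first_argmax_exists f : exists j, first_argmax f j.
Proof.
have [i0 m0] := max_ord_attained f.
pose Q (j : 'I_k.+1) := f j == max_ord f.
have Q0 : Q i0 by rewrite /Q m0.
case: (arg_minnP (P := Q) (fun j => j : nat) Q0) => j /eqP Qj jmin.
exists j; apply/forallP => i.
have fi : f i <= f j by rewrite Qj le_max_ord.
have [ji|ij] := leqP j i => /=; first by [].
rewrite lt_neqAle fi andbT; apply/negP => /eqP e.
have : Q i by rewrite /Q e Qj.
by move=> /jmin; rewrite leqNgt ij.
Qed.

Lemma first_argmax_uniq f i j : first_argmax f i -> first_argmax f j -> i = j.
Proof.
move=> /forallP/(_ j) + /forallP/(_ i).
have [ij|ji|/val_inj//] := ltngtP i j => /=.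
  by move=> h1 /(lt_le_trans)/(_ h1); rewrite ltxx.
by move=> h1 h2; have := lt_le_trans h1 h2; rewrite ltxx.
Qed.

Lemma measurable_max_ord d (T : measurableType d) (f : 'I_k.+1 -> T -> R) :
  (forall i, measurable_fun setT (f i)) ->
  measurable_fun setT (fun w => max_ord (fun i => f i w)).
Proof.
move=> mf; rewrite /max_ord; elim: (index_enum _) => [|i r IH].
  by under eq_fun do rewrite big_nil; exact: mf.
by under eq_fun do rewrite big_cons; exact: measurable_maxr.
Qed.

Lemma measurable_min_ord d (T : measurableType d) (f : 'I_k.+1 -> T -> R) :
  (forall i, measurable_fun setT (f i)) ->
  measurable_fun setT (fun w => min_ord (fun i => f i w)).
Proof.
move=> mf; rewrite /min_ord; elim: (index_enum _) => [|i r IH].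
  by under eq_fun do rewrite big_nil; exact: mf.
by under eq_fun do rewrite big_cons; exact: measurable_minr.
Qed.

End extremal_ord.

(** * The maximum of a Gaussian vector in a short interval *)

Section gaussian_maximum.
Context d (T : measurableType d) {R : realType} (P : probability T R) (m : nat).
Notation p := m.+1.
Variable Y : 'I_p -> T -> R.
Notation E f := (\int[P]_w f w)%R.
Notation bm := bounded_measurable.
Notation lin := (lin Y).
Notation cov := (cov P Y).
Hypothesis gaussY : forall a, exists2 s, 0 <= s & gaussian_rv P (lin a) 0 s.

Definition coord_vec (k : 'I_p) : 'rV[R]_p := delta_mx 0 k.

Lemma lin_coord k w : lin (coord_vec k) w = Y k w.
Proof.
rewrite /lin (bigD1 k)//= mxE !eqxx mul1r big1 ?addr0// => i ik.
by rewrite mxE (negbTE ik) andbF mul0r.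
Qed.

Definition sd k : R := Num.sqrt (cov (coord_vec k) (coord_vec k)).

Variable tau : R.
Hypothesis tau0 : 0 < tau.
Hypothesis tau_sd : forall k, tau <= sd k.

Lemma sd_gt0 k : 0 < sd k. Proof. exact: lt_le_trans (tau_sd k). Qed.

(** The coordinates are normalized to variance 1: then all correlations are at most
    1, which is what makes the bounds in [residual_half_space] monotone. *)
Definition std_vec k : 'rV[R]_p := (sd k)^-1 *: coord_vec k.

Lemma lin_std k w : lin (std_vec k) w = Y k w / sd k.
Proof. by rewrite linZ lin_coord mulrC. Qed.

Lemma cov_std k : cov (std_vec k) (std_vec k) = 1.
Proof.
rewrite (covZl gaussY) (covZr gaussY) mulrA -expr2 exprVn sqr_sqrtr ?cov_ge0//.
rewrite mulVf// gt_eqF//; have := sd_gt0 k; rewrite sqrtr_gt0//.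
Qed.

Lemma cov_std_le1 j k : cov (std_vec j) (std_vec k) <= 1.
Proof.
have := cov_ge0 P Y (std_vec j - std_vec k).
by rewrite (covBB gaussY) !cov_std; lra.
Qed.

Lemma std_gaussian_rv k : gaussian_rv P (lin (std_vec k)) 0 1.
Proof. by have := lin_gaussian_rv gaussY (std_vec k); rewrite cov_std sqrtr1. Qed.

Lemma Ex_std_indicator k (b : R -> bool) : measurable_fun setT b ->
  E (fun w => (b (lin (std_vec k) w))%:R) = fine (normal_prob 0 1 [set x | b x]).
Proof.
move=> mb; have [mU law] := std_gaussian_rv k.
rewrite Ex_bool; last exact: measurableT_comp.
congr fine.
have mS : measurable [set x | b x] by rewrite -[X in measurable X]setTI; apply: mb.
by have := law _ mS; rewrite /gaussian_law oner_eq0.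
Qed.

Variable t : R.
Definition threshold k := t / sd k.
Definition deviation k w := lin (std_vec k) w - threshold k.
Definition correlation j k := cov (std_vec j) (std_vec k).

(** The vector is the part of the [k]-th normalized coordinate that is
    uncorrelated with the [j]-th one. The inequality
    [deviation k <= deviation j] bounds this residual by
    [(1 - correlation j k) * lin (std_vec j) w + (threshold k - threshold j)];
    here [lin (std_vec j) w] is frozen at [threshold j]. The inequality is large
    when [j <= k], as in [first_argmax]. *)
Definition residual_half_space j k : @half_space R p :=
  (std_vec k - correlation j k *: std_vec j,
   (1 - correlation j k) * threshold j + (threshold k - threshold j),
   (j <= k)%N).

Definition residuals j := [seq residual_half_space j k | k <- enum 'I_p].

Lemma residuals_orthogonal j h : h \in residuals j -> cov (std_vec j) h.1.1 = 0.
Proof.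
move=> /mapP[k _ ->] /=.
by rewrite (covBr gaussY) (covZr gaussY) cov_std mulr1 subrr.
Qed.

Lemma lin_residual j k w : lin (residual_half_space j k).1.1 w =
  lin (std_vec k) w - correlation j k * lin (std_vec j) w.
Proof. by rewrite linB linZ. Qed.

(** The unfrozen bound on the residuals is nondecreasing in the [j]-th coordinate
    because correlations are at most 1, so below the threshold it is stronger
    than the frozen one. *)
Lemma argmax_residuals j w : first_argmax (deviation ^~ w) j -> deviation j w <= 0 ->
  in_polytope Y (residuals j) w.
Proof.
move=> /forallP jm dj; apply/allP => h /mapP[k _ ->].
have := jm k; have r1 := cov_std_le1 j k; rewrite -/(correlation j k) in r1.
have : 0 <= (1 - correlation j k) * - deviation j w by rewrite mulr_ge0//; lra.
rewrite /in_half_space lin_residual /deviation /=.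
by case: (j <= k)%N => /=; lra.
Qed.

(** By the same monotonicity, above the threshold the frozen bound is the stronger
    one. *)
Lemma residuals_argmax j w : in_polytope Y (residuals j) w -> 0 <= deviation j w ->
  first_argmax (deviation ^~ w) j.
Proof.
move=> /allP jm dj; apply/forallP => k.
have /jm : residual_half_space j k \in residuals j by rewrite map_f// mem_enum.
have r1 := cov_std_le1 j k; rewrite -/(correlation j k) in r1.
have : 0 <= (1 - correlation j k) * deviation j w by rewrite mulr_ge0//; lra.
rewrite /in_half_space lin_residual /deviation /=.
by case: (j <= k)%N => /=; lra.
Qed.

Definition residual_mass j := E (fun w => (in_polytope Y (residuals j) w)%:R).

Lemma bmeas_residuals j : bm (fun w => (in_polytope Y (residuals j) w)%:R : R).
Proof. by apply: bmeas_bool; exact: measurable_in_polytope. Qed.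

Lemma bmeas_std_lteif j u s : bm (fun w => (lin (std_vec j) w < u ?<= if s)%R%:R : R).
Proof. by apply: bmeas_bool; exact: (measurable_in_half_space gaussY (std_vec j, u, s)). Qed.

Lemma Ex_residuals_lteif j u s :
  E (fun w => (in_polytope Y (residuals j) w)%:R * (lin (std_vec j) w < u ?<= if s)%R%:R)
  = residual_mass j * E (fun w => (lin (std_vec j) w < u ?<= if s)%R%:R).
Proof. by apply: polytope_indep => // h; exact: residuals_orthogonal. Qed.

Lemma Ex_residuals_tail j :
  E (fun w => (in_polytope Y (residuals j) w)%:R *
    (threshold j <= lin (std_vec j) w)%R%:R)
  = residual_mass j * normal_tail (threshold j).
Proof.
pose I w : R := (lin (std_vec j) w < threshold j)%R%:R.
have bI : bm I by exact: (bmeas_std_lteif j (threshold j) false).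
have bP := bmeas_residuals j.
have IE w : (threshold j <= lin (std_vec j) w)%R%:R = 1 - I w.
  by rewrite /I leNgt; case: (_ < _); rewrite ?subr0 ?subrr.
have -> : normal_tail (threshold j) = E (fun w => 1 - I w).
  rewrite /normal_tail (_ : `[threshold j, +oo[%classic = [set x | (threshold j <= x)%R]); last first.
    by apply/seteqP; split => x /=; rewrite in_itv/= andbT.
  rewrite -(Ex_std_indicator j (b := fun x => threshold j <= x)); last exact: measurable_fun_ler.
  by apply: eq_Rintegral => w _; rewrite IE.
transitivity (E (fun w => (in_polytope Y (residuals j) w)%:R -
   (in_polytope Y (residuals j) w)%:R * I w)).
  by apply: eq_Rintegral => w _; rewrite IE mulrBr mulr1.
rewrite ExB//; last exact: bmeasM.
rewrite ExB//; last exact: bmeas_cst.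
rewrite (Ex_residuals_lteif j (threshold j) false) Ex_cst mulrBr mulr1//.
Qed.

Lemma Ex_residuals_itv j u v : u <= v ->
  E (fun w => (in_polytope Y (residuals j) w)%:R * (u <= lin (std_vec j) w <= v)%R%:R)
  = residual_mass j * fine (normal_prob 0 1 `[u, v]).
Proof.
move=> uv.
pose I w : R := (lin (std_vec j) w < u)%R%:R.
pose J w : R := (lin (std_vec j) w <= v)%R%:R.
have bI : bm I by exact: (bmeas_std_lteif j u false).
have bJ : bm J by exact: (bmeas_std_lteif j v true).
have bP := bmeas_residuals j.
have IE w : (u <= lin (std_vec j) w <= v)%R%:R = J w - I w.
  rewrite /I /J; have [h|h] := leP u (lin (std_vec j) w); first by rewrite subr0.
  by rewrite (le_trans (ltW h) uv) subrr.
have -> : fine (normal_prob 0 1 `[u, v]) = E (fun w => J w - I w).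
  rewrite (_ : `[u, v]%classic = [set x | (u <= x <= v)%R]); last first.
    by apply/seteqP; split => x /=; rewrite in_itv/=.
  rewrite -(Ex_std_indicator j (b := fun x => u <= x <= v)); last first.
    by apply: measurable_and; exact: measurable_fun_ler.
  by apply: eq_Rintegral => w _; rewrite IE.
transitivity (E (fun w => (in_polytope Y (residuals j) w)%:R * J w -
   (in_polytope Y (residuals j) w)%:R * I w)).
  by apply: eq_Rintegral => w _; rewrite IE mulrBr.
have bPJ := bmeasM bP bJ; have bPI := bmeasM bP bI.
rewrite ExB//.
rewrite ExB// (Ex_residuals_lteif j u false) (Ex_residuals_lteif j v true) mulrBr//.
Qed.

(** The events whose probabilities are summed, frozen bounds for [j] together with
    the [j]-th coordinate above its threshold, are disjoint because each of them
    forces [j] to be the argmax. *)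
Lemma sum_residuals_tail_le1 : \sum_j residual_mass j * normal_tail (threshold j) <= 1.
Proof.
under eq_bigr do rewrite -Ex_residuals_tail.
have bF j : bm (fun w => (in_polytope Y (residuals j) w)%:R *
    (threshold j <= lin (std_vec j) w)%R%:R : R).
  apply: bmeasM; first exact: bmeas_residuals.
  by apply: bmeas_bool; apply: measurable_fun_ler => //; exact: measurable_lin.
rewrite -Ex_sum// -[leRHS](Ex_cst P 1); apply: Ex_le.
- exact: bmeas_sum.
- exact: bmeas_cst.
move=> w.
have [j0 j0m] := first_argmax_exists (deviation ^~ w).
rewrite (bigD1 j0)//= big1 ?addr0.
  by rewrite -natrM lern1; case: in_polytope; case: (_ <= _).
move=> j jj0; case: (boolP (in_polytope Y (residuals j) w)) => [hp|_]; last by rewrite mul0r.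
case: (boolP (threshold j <= _)) => [hy|_]; last by rewrite mulr0.
have hd : 0 <= deviation j w by rewrite subr_ge0.
by move: jj0; rewrite (first_argmax_uniq (residuals_argmax hp hd) j0m) eqxx.
Qed.

Lemma residual_mass_ge0 j : 0 <= residual_mass j.
Proof. by apply: Ex_ge0 => w. Qed.

Lemma residual_mass_le1 j : residual_mass j <= 1.
Proof.
rewrite -[leRHS](Ex_cst P 1); apply: Ex_le; [exact: bmeas_residuals|exact: bmeas_cst|].
by move=> w; rewrite /=; case: in_polytope.
Qed.

Lemma measurable_coord k : measurable_fun setT (Y k).
Proof.
rewrite (_ : Y k = lin (coord_vec k)); first exact: measurable_lin.
by apply/funext => w; rewrite lin_coord.
Qed.

(** When the maximum lies in [t - eta, t], the [j]-th normalized coordinate, for [j]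
    the argmax of the deviations, lies within [eta / tau] below its threshold and
    the frozen bounds for [j] hold. By independence this has probability at most
    [residual_mass j] times the normal mass of a short interval, which
    [normal_itv_le] compares with the tail beyond the threshold; with
    [expR (- a ^+ 2 / 2) = 1 / p] the sum over [j] is at most [a + 5 / 4 + 3 / 4]
    times [eta / tau], by [sum_residuals_tail_le1]. *)
Lemma max_concentration_local (eta : R) :
  let a := Num.sqrt (2 * ln p%:R) in
  0 <= eta -> a * (eta / tau) * (4 * a + 5) <= 1 ->
  E (fun w => (t - eta <= max_ord (fun k => Y k w) <= t)%R%:R) <= eta / tau * (a + 2).
Proof.
move=> a eta0 small.
have p1 : 1 <= p%:R :> R by rewrite ler1n.
have lnp : 0 <= ln p%:R :> R by exact: ln_ge0.
have a0 : 0 <= a by exact: sqrtr_ge0.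
have expa : expR (- a ^+ 2 / 2) = p%:R^-1.
  rewrite sqr_sqrtr ?mulr_ge0// (_ : - (2 * ln p%:R) / 2 = - ln p%:R :> R); last by field.
  by rewrite expRN lnK// posrE.
set dl := eta / tau in small *.
have dl0 : 0 <= dl by rewrite divr_ge0// ltW.
have bmax : bm (fun w => (t - eta <= max_ord (fun k => Y k w) <= t)%R%:R : R).
  apply: bmeas_bool; apply: measurable_and; apply: measurable_fun_ler => //;
    by apply: measurable_max_ord; exact: measurable_coord.
have bF j : bm (fun w => (in_polytope Y (residuals j) w)%:R *
    (threshold j - dl <= lin (std_vec j) w <= threshold j)%R%:R : R).
  apply: bmeasM; first exact: bmeas_residuals.
  apply: bmeas_bool; apply: measurable_and; apply: measurable_fun_ler => //;
    exact: measurable_lin.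
apply: (@le_trans _ _ (\sum_j residual_mass j *
    fine (normal_prob 0 1 `[threshold j - dl, threshold j]))).
  under eq_bigr do rewrite -Ex_residuals_itv ?gerBl//.
  rewrite -Ex_sum//; apply: Ex_le => //; first exact: bmeas_sum.
  move=> w; case: (boolP (_ <= _ <= _)) => [/andP[Ml Mu]|_]; last first.
    by apply: sumr_ge0 => j _; rewrite mulr_ge0.
  (* the argmax is taken over the deviations, not over the coordinates themselves *)
  have [j jm] := first_argmax_exists (deviation ^~ w).
  have dev_le0 k : deviation k w <= 0.
    rewrite /deviation lin_std /threshold -mulrBl mulr_le0_ge0 ?invr_ge0 ?(ltW (sd_gt0 k))//.
    by rewrite subr_le0 (le_trans _ Mu)// (le_max_ord (fun k => Y k w)).
  have dj : - dl <= deviation j w.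
    have [k Mk] := max_ord_attained (fun k => Y k w).
    have : deviation k w <= deviation j w.
      by move/forallP : jm => /(_ k); case: (j <= k)%N => //= /ltW.
    apply: le_trans; rewrite /deviation lin_std /threshold -mulrBl.
    rewrite ler_pdivlMr ?sd_gt0//.
    apply: (@le_trans _ _ (- eta)); last by rewrite -Mk; lra.
    rewrite mulNr lerN2 /dl mulrAC ler_pdivlMr// ler_wpM2l//.
  rewrite (bigD1 j)//= argmax_residuals// mul1r.
  have -> : threshold j - dl <= lin (std_vec j) w <= threshold j.
    by apply/andP; move: dj (dev_le0 j); rewrite /deviation; split; lra.
  by rewrite lerDl sumr_ge0// => i _; rewrite mulr_ge0.
apply: (@le_trans _ _ (\sum_j
    (dl * (a + 5 / 4) * (residual_mass j * normal_tail (threshold j)) +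
     dl * (3 / 4) / p%:R))).
  apply: ler_sum => j _.
  apply: (le_trans (ler_wpM2l (residual_mass_ge0 j) (normal_itv_le (threshold j) a0 dl0 small))).
  rewrite expa.
  rewrite (_ : residual_mass j * _ =
      dl * (a + 5 / 4) * (residual_mass j * normal_tail (threshold j)) +
      residual_mass j * (dl * (3 / 4) / p%:R)); last by ring.
  rewrite lerD2l; apply: ler_piMl; last exact: residual_mass_le1.
  by rewrite divr_ge0// mulr_ge0//; lra.
rewrite big_split/= -mulr_sumr sumr_const card_ord -[_ *+ p]mulr_natr mulfVK ?pnatr_eq0//.
have := sum_residuals_tail_le1.
have : 0 <= dl * (a + 5 / 4) by rewrite mulr_ge0//; lra.
nra.
Qed.

End gaussian_maximum.

(** * Concentration of the maximum of a Gaussian vector *)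

Section row_maximum.
Context d (T : measurableType d) {R : realType} (P : probability T R) (m : nat).
Notation p := m.+1.
Variable Y : 'I_p -> T -> R.
Notation E f := (\int[P]_w f w)%R.
Hypothesis gaussY : forall a, exists2 s, 0 <= s & gaussian_rv P (lin Y a) 0 s.
Variable tau : R.
Hypothesis tau0 : 0 < tau.
Hypothesis tau_sd : forall k, tau <= sd P Y k.

Lemma bmeas_max_itv u v :
  bounded_measurable (fun w => (u <= max_ord (fun k => Y k w) <= v)%R%:R : R).
Proof.
have mM : measurable_fun setT (fun w => max_ord (fun k => Y k w)).
  by apply: measurable_max_ord => k; exact: measurable_coord gaussY k.
by apply: bmeas_bool; apply: measurable_and; exact: measurable_fun_ler.
Qed.

(** The bound for short intervals extends to long ones by subdivision. *)
Lemma max_concentration_iter u eta B (N : nat) :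
  0 <= eta ->
  (forall t, E (fun w => (t - eta <= max_ord (fun k => Y k w) <= t)%R%:R) <= B) ->
  E (fun w => (u <= max_ord (fun k => Y k w) <= u + N.+1%:R * eta)%R%:R) <= N.+1%:R * B.
Proof.
move=> eta0 HB; elim: N => [|N IH].
  by have := HB (u + 1 * eta); rewrite !mul1r addrK.
have bm := bmeas_max_itv.
apply: (@le_trans _ _ (E (fun w => (u <= max_ord (fun k => Y k w) <= u + N.+1%:R * eta)%R%:R
  + (u + N.+2%:R * eta - eta <= max_ord (fun k => Y k w) <= u + N.+2%:R * eta)%R%:R))).
  apply: Ex_le => //; first exact: bmeasD.
  move=> w; set M := max_ord _.
  have -> : u + N.+2%:R * eta - eta = u + N.+1%:R * eta.
    by rewrite -[N.+2%:R]natr1; ring.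
  have [h|h] := leP M (u + N.+1%:R * eta).
    rewrite andbT; case: (u <= M) => /=; last by rewrite addr_ge0.
    apply: (@le_trans _ _ 1); first by case: (M <= _).
    by rewrite lerDl.
  rewrite andbF add0r (ltW h) (le_trans _ (ltW h))// lerDl mulr_ge0//.
have -> : N.+2%:R * B = N.+1%:R * B + B by rewrite -[N.+2%:R]natr1 mulrDl mul1r.
by rewrite ExD// lerD.
Qed.

(** Nazarov's inequality: cut the interval of length [2 * eps] into pieces short
    enough for [max_concentration_local]. *)
Lemma gaussian_max_concentration x eps : 0 < eps ->
  E (fun w => (`|max_ord (fun k => Y k w) - x| <= eps)%R%:R) <=
  2 * Num.sqrt 2 * eps * (tau^-1 * (Num.sqrt 2 + Num.sqrt (ln p%:R))).
Proof.
move=> eps0.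
pose a : R := Num.sqrt (2 * ln p%:R).
have a0 : 0 <= a by exact: sqrtr_ge0.
(* more than [K] pieces are short enough *)
pose K := a * (2 * eps / tau) * (4 * a + 5).
pose N := Num.truncn K.
have NK : K <= N.+1%:R by apply/ltW; exact: truncnS_gt.
have c0 : N.+1%:R != 0 :> R by rewrite pnatr_eq0.
pose eta := 2 * eps / N.+1%:R.
have eta0 : 0 <= eta by rewrite divr_ge0// mulr_ge0// ltW.
have small : a * (eta / tau) * (4 * a + 5) <= 1.
  rewrite (_ : _ * _ = K / N.+1%:R); last first.
    rewrite /eta /K; move: N.+1%:R c0 => c c0.
    by field; rewrite c0 gt_eqF.
  by rewrite ler_pdivrMr ?mul1r.
have := @max_concentration_iter (x - eps) eta (eta / tau * (a + 2)) N eta0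
  (fun t => max_concentration_local gaussY tau0 tau_sd t eta0 small).
rewrite (_ : N.+1%:R * eta = 2 * eps); last by rewrite /eta; move: N.+1%:R c0 => c c0; field.
rewrite (_ : N.+1%:R * (eta / tau * (a + 2)) = 2 * eps / tau * (a + 2)); last first.
  by rewrite /eta; move: N.+1%:R c0 => c c0; field; rewrite c0 gt_eqF.
have -> : x - eps + 2 * eps = x + eps by ring.
under eq_Rintegral do rewrite -ler_distl.
move=> /le_trans; apply; rewrite le_eqVlt; apply/orP; left; apply/eqP.
have s22 : Num.sqrt 2 * Num.sqrt 2 = 2 :> R by rewrite -expr2 sqr_sqrtr.
rewrite /a sqrtrM//; set s2 := Num.sqrt 2 in s22 *; set l := Num.sqrt _.
have -> : s2 * l + 2 = s2 * (s2 + l) by rewrite mulrDr s22 addrC.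
by ring.
Qed.

End row_maximum.

(** * The rows of a Gaussian matrix *)

Section gaussian_matrix_rows.
Context d (T : measurableType d) {R : realType} (P : probability T R) (n m : nat).
Variable X : 'I_n.+1 -> 'I_m.+1 -> {RV P >-> R}.
Hypothesis gaussX : gaussian_matrix X.
Hypothesis centX : centered_matrix X.
Notation E f := (\int[P]_w f w)%R.
Notation row i := (fun j => (X i j : T -> R)).

Lemma gaussian_matrix_row i (b : 'rV[R]_m.+1) :
  exists mu, exists2 s, 0 <= s & gaussian_rv P (lin (row i) b) mu s.
Proof.
have [mu [s [s0 law]]] := gaussX (\matrix_(i', j) (if i' == i then b 0 j else 0)).
exists mu, s => //; split.
  by apply: measurable_sum => j; apply: measurable_funM.
move=> A mA; rewrite -law//; congr (pushforward P _ A); apply/funext => w.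
rewrite (bigD1 i)//= [X in _ = _ + X]big1 ?addr0 => [|i' ii'].
  by apply: eq_bigr => j _; rewrite mxE eqxx.
by rewrite big1// => j _; rewrite mxE (negbTE ii') mul0r.
Qed.

Lemma lin_coord_row i j : lin (row i) (coord_vec j) = X i j.
Proof. by apply/funext => w; rewrite lin_coord. Qed.

Lemma integrable_entry i j : P.-integrable setT (EFin \o X i j).
Proof.
have [mu [s _]] := gaussian_matrix_row i (coord_vec j).
by rewrite lin_coord_row => /gaussian_rv_mean[].
Qed.

Lemma Ex_entry i j : E (X i j) = 0.
Proof. by have := centX i j; rewrite unlock /Rintegral => ->. Qed.

(** It identifies the mean of the Gaussian law of a linear combination, which the
    definition of a Gaussian matrix leaves unspecified. *)
Lemma Ex_lin_row i b : E (lin (row i) b) = 0.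
Proof.
rewrite /lin.
suff H (r : seq 'I_m.+1) :
    P.-integrable setT (EFin \o (fun w => \sum_(k <- r) b 0 k * X i k w)) /\
    E (fun w => \sum_(k <- r) b 0 k * X i k w) = 0 by have [] := H (index_enum _).
elim: r => [|k r [ir Er]].
  split.
    have := @finite_measure_integrable_cst _ _ R P setT 0 measurableT.
    by apply: eq_integrable => // w _; rewrite /= big_nil.
  by under eq_Rintegral do rewrite big_nil; rewrite Rintegral_cst// mul0r.
have ik : P.-integrable setT (EFin \o (fun w => b 0 k * X i k w)).
  by have := integrableZl measurableT (b 0 k) (integrable_entry i k); apply: eq_integrable.
split.
  have := integrableD measurableT ik ir.
  by apply: eq_integrable => // w _; rewrite /= big_cons EFinD.
under eq_Rintegral do rewrite big_cons.
rewrite RintegralD// Er addr0 RintegralZl ?Ex_entry ?mulr0//; exact: integrable_entry.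
Qed.

Lemma gaussian_row_centered i (b : 'rV[R]_m.+1) :
  exists2 s, 0 <= s & gaussian_rv P (lin (row i) b) 0 s.
Proof.
have [mu [s s0 g]] := gaussian_matrix_row i b.
have [_] := gaussian_rv_mean g; rewrite Ex_lin_row => mu0.
by exists s => //; rewrite mu0.
Qed.

Lemma sd_sigma i j : sd P (row i) j = sigma X i j.
Proof.
rewrite /sd /sigma /variance; congr (Num.sqrt _).
rewrite unlock /cov /Rintegral; congr fine.
rewrite unlock; apply: eq_integral => w _.
rewrite !lin_coord_row /=; have := Ex_entry i j; rewrite /Rintegral => ->.
by rewrite fctE /= subr0.
Qed.

End gaussian_matrix_rows.

Theorem lemma10 (d : measure_display) (T : measurableType d) (R : realType)
    (P : probability T R) (n m : nat)
    (X : 'I_n.+1 -> 'I_m.+1 -> {RV P >-> R})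
    (gaussX : gaussian_matrix X) (centX : centered_matrix X)
    (sigma_gt0 : 0 < sigma_min X) (condA : minmax_as_unique X)
    (eps : R) (eps_gt0 : 0 < eps) :
  (levy_concentration P (fun w => minmax (sample X w)) eps <=
     (2 * Num.sqrt 2 * eps *
      \sum_(i < n.+1) (sigma_row X i)^-1 *
        (Num.sqrt 2 + Num.sqrt (ln m.+1%:R)))%:E)%E
  /\
  2 * Num.sqrt 2 * eps *
    \sum_(i < n.+1) (sigma_row X i)^-1 *
      (Num.sqrt 2 + Num.sqrt (ln m.+1%:R))
  <= 2 * Num.sqrt 2 * (eps / sigma_min X) * n.+1%:R *
      (Num.sqrt 2 + Num.sqrt (ln m.+1%:R)).
Proof.
set L : R := Num.sqrt 2 + Num.sqrt _.
have L0 : 0 <= L by rewrite addr_ge0// sqrtr_ge0.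
have row_ge i : sigma_min X <= sigma_row X i.
  rewrite /sigma_row; have [j ->] := min_ord_attained (fun j => sigma X i j).
  exact: (bigmin_le _ (i, j) (fun q : 'I_n.+1 * 'I_m.+1 => sigma X q.1 q.2)).
have row_gt0 i : 0 < sigma_row X i := lt_le_trans sigma_gt0 (row_ge i).
split.
- apply: ge_ereal_sup => _ [x _ <-].
  pose M i w := max_ord (fun j => X i j w).
  have mM i : measurable_fun setT (M i) by exact: measurable_max_ord.
  have minmaxE w : minmax (sample X w) = min_ord (fun i => M i w).
    by congr min_ord; apply/funext => i; congr max_ord; apply/funext => j; rewrite mxE.
  have mdist (Z : T -> R) : measurable_fun setT Z ->
      measurable_fun setT (fun w => `|Z w - x| <= eps).
    move=> mZ; apply: measurable_fun_ler => //.
    by apply: measurableT_comp => //; exact: measurable_funB.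
  have mmin : measurable_fun setT (fun w => min_ord (fun i => M i w)).
    exact: measurable_min_ord.
  have mev := mdist _ mmin.
  rewrite (_ : [set w | _] = [set w | `|min_ord (fun i => M i w) - x| <= eps]); last first.
    by apply/seteqP; split => w /=; rewrite minmaxE.
  rewrite -[leLHS]fineK; last first.
    by rewrite fin_num_measure// -[X in measurable X]setTI; apply: mev.
  rewrite -(Ex_bool P mev) lee_fin.
  have bM i : bounded_measurable (fun w => (`|M i w - x| <= eps)%R%:R : R).
    by apply: bmeas_bool; exact: mdist.
  apply: (@le_trans _ _ (\int[P]_w (\sum_(i < n.+1) (`|M i w - x| <= eps)%R%:R))).
    apply: Ex_le; [exact: bmeas_bool|exact: bmeas_sum|] => w.
    (* the minimum is one of the row maxima, whence a union bound over the rows *)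
    have [i ->] := min_ord_attained (fun i => M i w).
    by rewrite (bigD1 i)//= lerDl sumr_ge0.
  rewrite Ex_sum// mulr_sumr; apply: ler_sum => i _.
  apply: (gaussian_max_concentration (Y := fun j => X i j)) => //.
    exact: gaussian_row_centered gaussX centX i.
  by move=> k; rewrite sd_sigma// min_ord_le.
- rewrite -mulr_suml [leRHS](_ : _ = 2 * Num.sqrt 2 * eps *
    (n.+1%:R / sigma_min X * L)); last by ring.
  rewrite ler_wpM2l ?mulr_ge0 ?sqrtr_ge0 ?(ltW eps_gt0)// ler_wpM2r//.
  rewrite -[X in X%:R]card_ord mulr_natl -sumr_const; apply: ler_sum => i _.
  by rewrite lef_pV2 ?posrE.
Qed.
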